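(* Let $n\ge 2$, let $h:[n]\to[n]$ be an indecomposable Hessenberg function and let $\mathsf{n}=E_{1n}\in\mathfrak{gl}_n(\mathbb{C})$. Then $$\mathcal{I}_{\mathsf{n},h}=\bigcap_{i\in\mathcal{C}(h)}\left(\mathcal{J}^0_{i-1}+\mathcal{K}_{h(i)}\right).$$ In particular, $\{\mathcal{J}^0_{i-1}+\mathcal{K}_{h(i)}\mid i\in\mathcal{C}(h)\}$ is the set of associated primes of $\mathcal{I}_{\mathsf{n},h}$. Furthermore, the nilpotent matrix Hessenberg scheme $\mathcal{Y}_{\mathsf{n},h}$ is reduced and a union of matrix Schubert varieties, $$\mathcal{Y}_{\mathsf{n},h}=\bigcup_{i\in\mathcal{C}(h)}\mathcal{X}_{w_0w[i,h(i)]},$$ where $w[i,h(i)]=u[i]v[h(i)]$ is the shortest permutation $w$ in $S_n$ such that $w(i)=1$ and $w(h(i))=n$.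
   Context: Let $[n]=\{1,\dots,n\}$. A Hessenberg function is a map $h:[n]\to[n]$ with $h(i)\le h(i+1)$ for $i<n$ and $h(i)\ge i$ for all $i$; it is indecomposable if $h(i)>i$ for all $i<n$. Set $h(0)=0$; the set of corners is $\mathcal{C}(h)=\{i\in[n]\mid h(i)>h(i-1)\}$. $E_{ij}$ is the matrix unit. Let $\mathbf{z}=\{z_{ij}\mid 1\le i,j\le n\}$, $Z=(z_{ij})$, $d=\det Z$, $M_n(\mathbb{C})=\operatorname{Spec}\mathbb{C}[\mathbf{z}]$, and let $v_j=\sum_i z_{ij}e_i$ be the $j$-th column of $Z$. For $\mathsf{x}\in \mathfrak{gl}_n(\mathbb{C})$ and each $i$ with $h(i)<n$ let $\mathcal{I}_{\mathsf{x},h,i}\subseteq\mathbb{C}[\mathbf{z}]$ be the ideal generated by all $(h(i)+1)\times(h(i)+1)$ minors of the $n\times(i+h(i))$ matrix $[\mathsf{x}v_1\ \cdots\ \mathsf{x}v_i\ v_1\ \cdots\ v_{h(i)}]$, and $\mathcal{I}_{\mathsf{x},h,i}=0$ if $h(i)=n$. Put $\mathcal{I}_{\mathsf{x},h}=\sum_{i\in[n]}\mathcal{I}_{\mathsf{x},h,i}$, let $\tilde{\mathcal{I}}_{\mathsf{x},h}=\{f\mid d^kf\in\mathcal{I}_{\mathsf{x},h}\text{ for some }k\ge0\}$, and $\mathcal{Y}_{\mathsf{x},h}=\operatorname{Spec}\mathbb{C}[\mathbf{z}]/\tilde{\mathcal{I}}_{\mathsf{x},h}$. Define ideals of $\mathbb{C}[\mathbf{z}]$: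 $\mathcal{J}^0_i=\langle z_{n1},\dots,z_{ni}\rangle$ for $i\in[n]$, $\mathcal{J}^0_0=\langle0\rangle$, and $\mathcal{K}_j=\langle p_B\mid B\subseteq\{2,\dots,n\},\ |B|=j\rangle$ for $j\in[n]$, where $p_B=\det(z_{k\ell})_{k\in B,\,1\le\ell\le j}$ (so $\mathcal{K}_n=\langle0\rangle$). For $w\in S_n$ let $\dot w$ be the permutation matrix with entry $1$ in row $w(j)$, column $j$, for each $j$. The matrix Schubert variety is $\mathcal{X}_w=\overline{B\dot wB}\subseteq M_n(\mathbb{C})$ (reduced), with $B$ the invertible upper triangular matrices. $w_0$ is the longest permutation, $w_0(k)=n+1-k$. The length of $w$ is its number of inversions; $u[k]$ is the shortest permutation $u$ with $u(k)=1$, and $v[k]$ is the shortest permutation $v$ with $v(k)=n$. *)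

(* Defs.v *)
From HB Require Import structures.
From mathcomp Require Import all_boot all_order all_algebra all_fingroup.
From mathcomp Require Import mpoly complex.
From mathcomp Require Import boolp classical_sets reals.

Set Implicit Arguments.
Unset Strict Implicit.
Unset Printing Implicit Defensive.

Import GRing.Theory.
Local Open Scope ring_scope.
Local Open Scope classical_set_scope.

(* Indices run over 'I_n = {0, ..., n-1}: the ordinal i encodes i + 1 in [n].
   In particular the 1-based value h(i+1) is (h i).+1, and i : nat is the
   1-based index of i minus one. *)

Section Ideals.
Variable A : comNzRingType.

Definition ideal_gen (G : set A) : set A :=
  [set f | exists s : seq (A * A),
     (forall p, p \in s -> G p.2) /\ f = \sum_(p <- s) p.1 * p.2].

Definition ideal_add (I J : set A) : set A :=
  [set f | exists2 a, I a & exists2 b, J b & f = a + b].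

Definition ideal_sum (T : finType) (I : T -> set A) : set A :=
  [set f | exists g : T -> A, (forall i, I i (g i)) /\ f = \sum_i g i].

(* { f | d^k f in I for some k } *)
Definition saturation (d : A) (I : set A) : set A :=
  [set f | exists k : nat, I (d ^+ k * f)].

(* idealr_closed includes properness: 1 is not in the ideal. *)
Definition prime_ideal (P : set A) : Prop :=
  idealr_closed (mem P) /\ prime_idealr_closed (mem P).

(* The prime ideals that are the annihilator in A / I of the class of some
   element f. *)
Definition associated_primes (I : set A) : set (set A) :=
  [set P | prime_ideal P /\ exists f, P = [set g | I (g * f)]].

(* A / I has no nonzero nilpotent element. *)
Definition reduced_quotient (I : set A) : Prop :=
  forall (f : A) (k : nat), I (f ^+ k) -> I f.

End Ideals.

Definition increasing (k m : nat) (f : 'I_k -> 'I_m) : Prop :=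
  forall a b : 'I_k, (a < b)%N -> (f a < f b)%N.

(* A set of k rows (columns) is given by its increasing enumeration. *)
Definition minors (A : comNzRingType) (k m p : nat) (M : 'M[A]_(m, p)) : set A :=
  [set x | exists (f : 'I_k -> 'I_m) (g : 'I_k -> 'I_p),
     [/\ increasing f, increasing g & x = \det (mxsub f g M)]].

Section Hessenberg.
Variable n : nat.
Implicit Type h : 'I_n -> 'I_n.

Definition hessenberg h : Prop :=
  (forall i j : 'I_n, j = i.+1 :> nat -> (h i <= h j)%N) /\
  (forall i : 'I_n, (i <= h i)%N).

Definition indecomposable h : Prop :=
  forall i : 'I_n, (i.+1 < n)%N -> (i < h i)%N.

(* Since h(0) = 0, the first index is always a corner. *)
Definition corners h : set 'I_n :=
  [set i : 'I_n | forall j : 'I_n, i = j.+1 :> nat -> (h j < h i)%N].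

End Hessenberg.

Section Permutations.
Variable n : nat.
Implicit Type w : 'S_n.

Definition perm_length w : nat :=
  #|[set p : 'I_n * 'I_n | (p.1 < p.2)%N && (w p.2 < w p.1)%N]%SET|.

Definition is_shortest (P : pred 'S_n) w : bool :=
  P w && [forall w', P w' && (w' != w) ==> (perm_length w < perm_length w')%N].

Definition shortest (P : pred 'S_n) : 'S_n :=
  odflt 1%g [pick w | is_shortest P w].

Definition perm_w0 : 'S_n := perm (@rev_ord_inj n).

Definition perm_u (k : 'I_n) : 'S_n := shortest (fun u => u k == 0%N :> nat).

Definition perm_v (k : 'I_n) : 'S_n := shortest (fun v => (v k).+1 == n).

(* Product of permutations as composition of functions, (s t)(k) = s (t k);
   the product of the group 'S_n composes in the opposite order. *)
Definition perm_comp (s t : 'S_n) : 'S_n := (t * s)%g.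

(* w[i, j] = u[i] v[j] *)
Definition perm_w (i j : 'I_n) : 'S_n := perm_comp (perm_u i) (perm_v j).

End Permutations.

Section MatrixSpace.
Variables (C : fieldType) (n : nat).

(* C[z_ij], the n * n variables being indexed by pairs through mxvec_index. *)
Definition coord_ring := {mpoly C[n * n]}.

Definition generic_mx : 'M[coord_ring]_n :=
  \matrix_(i, j) 'X_(mxvec_index i j).

Definition eval_mx (M : 'M[C]_n) (f : coord_ring) : C :=
  f.@[fun k => mxvec M 0 k].

Definition first_cols (k : 'I_n) (M : 'M[coord_ring]_n) :
    'M[coord_ring]_(n, k.+1) :=
  colsub (widen_ord (ltn_ord k)) M.

(* [ x v_1 ... x v_i  v_1 ... v_h(i) ] *)
Definition hess_mx (x : 'M[C]_n) (h : 'I_n -> 'I_n) (i : 'I_n) :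
    'M[coord_ring]_(n, i.+1 + (h i).+1) :=
  row_mx (first_cols i (map_mx (@mpolyC (n * n) C) x *m generic_mx))
         (first_cols (h i) generic_mx).

Definition hess_ideal_at (x : 'M[C]_n) (h : 'I_n -> 'I_n) (i : 'I_n) :
    set coord_ring :=
  if ((h i).+1 < n)%N then ideal_gen (@minors _ (h i).+2 _ _ (hess_mx x h i))
  else [set 0].

Definition hess_ideal (x : 'M[C]_n) (h : 'I_n -> 'I_n) : set coord_ring :=
  ideal_sum (hess_ideal_at x h).

(* The ideal defining the closed subscheme Y_{x,h} of M_n. *)
Definition hess_scheme_ideal (x : 'M[C]_n) (h : 'I_n -> 'I_n) :
    set coord_ring :=
  saturation (\det generic_mx) (hess_ideal x h).

(* J^0_k, for 0 <= k <= n *)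
Definition ideal_J0 (k : nat) : set coord_ring :=
  ideal_gen [set f | exists i j : 'I_n,
    [/\ i.+1 = n, (j < k)%N & f = generic_mx i j]].

(* K_{j+1}; the set B is given by its increasing enumeration. *)
Definition ideal_K (j : 'I_n) : set coord_ring :=
  ideal_gen [set p | exists B : 'I_j.+1 -> 'I_n,
    [/\ increasing B, forall a, (0 < B a)%N
      & p = \det (mxsub B (widen_ord (ltn_ord j)) generic_mx)]].

(* E_{1n} *)
Definition nilp_mx : 'M[C]_n :=
  \matrix_(i, j) ((i == 0%N :> nat) && (j.+1 == n))%:R.

Definition vanishing_ideal (S : set 'M[C]_n) : set coord_ring :=
  [set f | forall M, S M -> eval_mx M f = 0].

Definition zero_locus (I : set coord_ring) : set 'M[C]_n :=
  [set M | forall f, I f -> eval_mx M f = 0].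

Definition zariski_closure (S : set 'M[C]_n) : set 'M[C]_n :=
  zero_locus (vanishing_ideal S).

Definition upper_triangular_unit : set 'M[C]_n :=
  [set b | b \in unitmx /\ is_trig_mx b^T].

(* perm_mx w has its 1s at the positions (j, w j), hence the transpose. *)
Definition perm_dot (w : 'S_n) : 'M[C]_n := (perm_mx w)^T.

Definition matrix_schubert (w : 'S_n) : set 'M[C]_n :=
  zariski_closure [set M | exists2 b, upper_triangular_unit b &
    exists2 b', upper_triangular_unit b' & M = b *m perm_dot w *m b'].

(* The ideal of the variety X_w as a reduced closed subscheme of M_n. *)
Definition matrix_schubert_ideal (w : 'S_n) : set coord_ring :=
  vanishing_ideal (matrix_schubert w).

End MatrixSpace.

(* Main.v *)
Require Import Defs.
From HB Require Import structures.
From mathcomp Require Import all_boot all_order all_algebra all_fingroup.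
From mathcomp Require Import mpoly complex.
From mathcomp Require Import zify.
From mathcomp Require Import boolp classical_sets reals.

Set Implicit Arguments.
Unset Strict Implicit.
Unset Printing Implicit Defensive.

Import GRing.Theory Num.Theory.
Local Open Scope ring_scope.
Local Open Scope classical_set_scope.

(** In this comment rows and columns are numbered from 1, as in the theorem;
    in the code ordinals start at 0.

    Since N = E_1n, the matrix N Z has a single non-zero row: its top row,
    which is the last row of Z.  A minor of the matrix with columns N v_1, ...,
    N v_i, v_1, ..., v_h(i) that is not forced to vanish is therefore
    +/- z_nj p_B with j <= i, and the ideal of N and h is the sum of the
    products J0_i K_h(i).

    The main point is that J0_(a-1) + K_k, for a < k, is the full vanishing
    ideal of the degeneracy locus: the matrices whose last row starts with a-1
    zeros and whose column k is, below the top row, a linear combination of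
    the previous columns (JK_ideal_vanishing).  Two facts give this.
    - Spanning (all_reducible).  Subtracting multiples of the generators
      replaces the product of the variables on the diagonal of a p_B by
      monomials of smaller weight, so modulo the ideal every polynomial is a
      combination of standard monomials: those without such a diagonal, and
      without the first a-1 variables of the last row.
    - Independence (standard_vanish).  A combination of standard monomials
      that vanishes on the locus is zero.  This goes by induction on the rows:
      letting the entry of the last row in column k tend to infinity makes the
      locus degenerate to one with a row and a column less, and the terms of
      top degree in that entry are again standard for the smaller locus.
    The hypothesis a < k leaves two entries of the last row free, in the columns
    k-1 and k; the degeneration needs both.

    The locus is parametrized by an affine space: two of its points lie on a
    polynomial curve inside it.  Hence its ideal is prime (JK_prime), and hence
    J0_a and K_k, for a < k, intersect in their product (J0_cap_K): a variable
    of the last row outside J0_(a-1) is not in the prime J0_(a-1) + K_k.  With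
    the modular law, going through the indices 1, 2, ..., n, this gives the
    intersection formula (hess_ideal_cap).  The primes obtained at the corners
    are pairwise incomparable, so they are the associated primes
    (associated_primes_cap), and their intersection is reduced.  None of them
    contains det Z, so saturating by det Z changes nothing.

    For the matrix Schubert varieties it remains to see that the cell B w B,
    for w = w_0 w[i,h(i)], is dense in the degeneracy locus (cell_vanishing).
    A point M of the locus is joined to the permutation matrix of w by a curve
    in the locus.  At the end of the curve M w^-1 becomes the identity, so at
    a general point it is a product U L of an upper and a lower triangular
    matrix.  The few non-inversions of w are exactly the places where w^-1 L w
    could fail to be upper triangular, and the equations of the locus make
    these entries zero (generic_in_cell).

    The permutations are identified by their inversion sets: the conditions
    w(i) = 1 and w(k) = n force certain inversions, and a permutation with no
    others is the unique shortest one (shortest_inversions). *)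

(** * Evaluation along polynomial curves *)

Section Curves.
Variables (C : numFieldType) (n : nat).
Implicit Types (f g : coord_ring C n) (M : 'M[C]_n) (P : 'M[{poly C}]_n).

(** The field is infinite, so a non-zero [p * q] has a point where neither
    factor vanishes. *)
Lemma poly_vanish (p q : {poly C}) :
  q != 0 -> (forall t, q.[t] != 0 -> p.[t] = 0) -> p = 0.
Proof.
move=> q0 pq; have: p * q == 0.
  apply/negPn/negP => pq0.
  pose rs : seq C := [seq i%:R | i <- iota 0 (size (p * q)%R)].
  suff : (size rs < size (p * q)%R)%N by rewrite size_map size_iota ltnn.
  apply: max_poly_roots => //.
    apply/allP => x _; rewrite /root hornerM.
    by have [->|/pq->] := eqVneq q.[x] 0; rewrite ?mulr0 ?mul0r eqxx.
  rewrite map_inj_uniq ?iota_uniq // => i j /eqP.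
  by rewrite eqr_nat => /eqP.
by rewrite mulf_eq0 (negbTE q0) orbF => /eqP.
Qed.

Lemma prod_mxvec (R : comPzSemiRingType) (F : 'I_(n * n) -> R) :
  \prod_k F k = \prod_i \prod_j F (mxvec_index i j).
Proof.
rewrite pair_big (reindex _ (curry_mxvec_bij n n)) /=.
by apply: eq_bigr => -[].
Qed.

Lemma eval_mxE M f : eval_mx M f =
  \sum_(s <- msupp f) f@_s * \prod_i \prod_j M i j ^+ s (mxvec_index i j).
Proof.
rewrite /eval_mx mevalE; apply: eq_bigr => s _; congr (_ * _).
rewrite prod_mxvec; apply: eq_bigr => i _; apply: eq_bigr => j _.
by rewrite mxvecE.
Qed.

Lemma eval_mx_eq M M' f :
  (forall s i j, s \in msupp f -> s (mxvec_index i j) != 0%N -> M i j = M' i j) ->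
  eval_mx M f = eval_mx M' f.
Proof.
move=> eqM; rewrite !eval_mxE; apply: eq_big_seq => s sf; congr (_ * _).
apply: eq_bigr => i _; apply: eq_bigr => j _.
have [->|s0] := eqVneq (s (mxvec_index i j)) 0%N; first by rewrite !expr0.
by rewrite (eqM s).
Qed.

Definition curve_at P t : 'M[C]_n := \matrix_(i, j) (P i j).[t].

Definition along P f : {poly C} := mmap (@polyC C) (fun k => mxvec P 0 k) f.

Lemma along_horner P f t : (along P f).[t] = eval_mx (curve_at P t) f.
Proof.
rewrite /along /mmap horner_sum eval_mxE; apply: eq_bigr => s _.
rewrite hornerM hornerC /mmap1 horner_prod prod_mxvec; congr (_ * _).
apply: eq_bigr => i _; apply: eq_bigr => j _.
by rewrite horner_exp mxvecE mxE.
Qed.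

(** A polynomial that vanishes at the general points of a curve vanishes at all
    of them: this is how Zariski density is used below. *)
Lemma curve_vanish P f (q : {poly C}) : q != 0 ->
  (forall t, q.[t] != 0 -> eval_mx (curve_at P t) f = 0) ->
  forall t, eval_mx (curve_at P t) f = 0.
Proof.
move=> q0 fP t; rewrite -along_horner.
rewrite (@poly_vanish (along P f) q) ?horner0 // => u qu.
by rewrite along_horner fP.
Qed.

Definition degree_part (x : 'I_(n * n)) (D : nat) f : coord_ring C n :=
  \sum_(s <- msupp f | s x == D) f@_s *: 'X_[s].

Lemma mcoeff_degree_part x D f s :
  (degree_part x D f)@_s = if s x == D then f@_s else 0.
Proof.
rewrite /degree_part raddf_sum /=.
have [sf|sf] := boolP (s \in msupp f); last first.
  rewrite (memN_msupp_eq0 sf) if_same big_seq_cond big1 // => m /andP[mf _].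
  rewrite mcoeffZ mcoeffX; case: eqP => [ms|_]; last by rewrite mulr0.
  by rewrite -ms mf in sf.
rewrite big_mkcond (bigD1_seq s) ?msupp_uniq //= mcoeffZ mcoeffX eqxx mulr1.
rewrite big1 ?addr0 // => m ms; case: ifP => // _.
by rewrite mcoeffZ mcoeffX (negbTE ms) mulr0.
Qed.

Lemma msupp_degree_part x D f s :
  s \in msupp (degree_part x D f) -> s \in msupp f /\ s x = D.
Proof.
rewrite !mcoeff_msupp mcoeff_degree_part.
by case: (s x =P D) => //; rewrite eqxx.
Qed.

Lemma eval_degree_part x D M f : eval_mx M (degree_part x D f) =
  \sum_(s <- msupp f | s x == D)
     f@_s * \prod_i \prod_j M i j ^+ s (mxvec_index i j).
Proof.
rewrite /degree_part /eval_mx rmorph_sum; apply: eq_bigr => s _ /=.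
rewrite mevalZ mevalX; congr (_ * _); rewrite prod_mxvec.
by apply: eq_bigr => i _; apply: eq_bigr => j _; rewrite mxvecE.
Qed.

Definition set_entry (R : Type) (M : 'M[R]_n) (a b : 'I_n) (x : R) : 'M[R]_n :=
  \matrix_(i, j) if (i == a) && (j == b) then x else M i j.

Lemma prod_set_entry (R : comNzRingType) (M : 'M[R]_n) a b x (e : 'I_n -> 'I_n -> nat) :
  \prod_i \prod_j set_entry M a b x i j ^+ e i j =
  x ^+ e a b * \prod_i \prod_j set_entry M a b 1 i j ^+ e i j.
Proof.
rewrite !pair_big (bigD1 (a, b)) //= [in RHS](bigD1 (a, b)) //= !mxE !eqxx /=.
rewrite expr1n mul1r; congr (_ * _); apply: eq_bigr => -[i j] /=.
by rewrite xpair_eqE !mxE => /negbTE->.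
Qed.

(** Degeneration: let the entry (a, b) be [1 / t] and multiply the value of [f]
    by [t ^ D].  The result is a polynomial in [t], whose value at [t = 0]
    only involves the terms of top degree in that entry. *)
Lemma top_degree_vanish P f a b D (q : {poly C}) : q != 0 ->
  (forall s, s \in msupp f -> (s (mxvec_index a b) <= D)%N) ->
  (forall t, t != 0 -> q.[t] != 0 ->
     eval_mx (set_entry (curve_at P t) a b t^-1) f = 0) ->
  eval_mx (curve_at P 0) (degree_part (mxvec_index a b) D f) = 0.
Proof.
move=> q0 leD fP; set x := mxvec_index a b.
(* [t ^ D] times the value of [f]; truncated subtraction is harmless by [leD]. *)
pose F : {poly C} := \sum_(s <- msupp f) (f@_s)%:P * ('X ^+ (D - s x) *
  \prod_i \prod_j set_entry P a b 1 i j ^+ s (mxvec_index i j)).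
have Fh t : F.[t] = \sum_(s <- msupp f) f@_s * (t ^+ (D - s x) *
    \prod_i \prod_j set_entry (curve_at P t) a b 1 i j ^+ s (mxvec_index i j)).
  rewrite horner_sum; apply: eq_bigr => s _.
  rewrite !hornerM hornerC hornerXn horner_prod; congr (_ * (_ * _)).
  apply: eq_bigr => i _; rewrite horner_prod; apply: eq_bigr => j _.
  by rewrite horner_exp !mxE; case: ifP; rewrite ?hornerE.
have F0 : F = 0.
  apply: (@poly_vanish _ ('X * q)); first by rewrite mulf_neq0 ?polyX_eq0.
  move=> t; rewrite hornerM hornerX mulf_eq0 negb_or => /andP[t0 qt].
  suff -> : F.[t] = t ^+ D * eval_mx (set_entry (curve_at P t) a b t^-1) f.
    by rewrite fP // mulr0.
  rewrite Fh eval_mxE mulr_sumr; apply: eq_big_seq => s sf.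
  rewrite [in RHS](prod_set_entry _ _ _ _ (fun i j => s (mxvec_index i j))) -/x.
  rewrite [RHS]mulrCA; congr (_ * _); rewrite [RHS]mulrA; congr (_ * _).
  by rewrite exprVn expfB_cond // (negbTE t0) leD.
have := Fh 0; rewrite F0 horner0 => /esym E0.
rewrite eval_degree_part.
have [M0 ->]: exists x0, curve_at P 0 = set_entry (curve_at P 0) a b x0.
  exists (curve_at P 0 a b); apply/matrixP => i j; rewrite [RHS]mxE.
  by case: ifP => // /andP[/eqP-> /eqP->].
rewrite -[RHS](mulr0 (M0 ^+ D)) -[in RHS]E0 mulr_sumr big_mkcond /=.
apply: eq_big_seq => s sf; case: eqP => [sD | /eqP sD].
  rewrite (prod_set_entry _ _ _ _ (fun i j => s (mxvec_index i j))) -/x sD.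
  by rewrite subnn expr0 mul1r mulrCA.
rewrite expr0n subn_eq0 leqNgt ltn_neqAle sD leD //=.
by rewrite mul0r !mulr0.
Qed.

End Curves.

(** * Standard monomials are independent on the degeneracy locus *)

Section StandardMonomials.
Variables (C : numFieldType) (n : nat).
Implicit Types (f g : coord_ring C n.+1) (M : 'M[C]_n.+1).
Implicit Types (s : 'X_{1..n.+1 * n.+1}) (i j : 'I_n.+1).

Lemma seq_argmax (T : eqType) (F : T -> nat) (r : seq T) : r != [::] ->
  exists2 x, x \in r & forall y, y \in r -> (F y <= F x)%N.
Proof.
elim: r => // x [|y r] IH _.
  by exists x; rewrite ?mem_head // => z; rewrite inE => /eqP->.
have [//|z zr zmax] := IH; have [xz|zx] := leqP (F x) (F z).
  exists z; first by rewrite inE zr orbT.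
  by move=> w; rewrite inE => /orP[/eqP->|/zmax].
exists x; first exact: mem_head.
move=> w; rewrite inE => /orP[/eqP->//|/zmax wz].
exact: leq_trans wz (ltnW zx).
Qed.

Lemma msupp_argmax (x : 'I_(n.+1 * n.+1)) f : f != 0 ->
  exists2 s, s \in msupp f & forall s', s' \in msupp f -> (s' x <= s x)%N.
Proof. by rewrite -msupp_eq0 => /(seq_argmax (fun s => s x)). Qed.

(** Induction on the number of variables in which the exponents of [f] are not
    constant: the terms of top degree in one variable inherit the vanishing. *)
Lemma eval_mx_inj0 f : (forall M, eval_mx M f = 0) -> f = 0.
Proof.
suff H l : forall f, (forall s s' (x : 'I_(n.+1 * n.+1)), s \in msupp f ->
    s' \in msupp f -> (l <= x)%N -> s x = s' x) ->
    (forall M, eval_mx M f = 0) -> f = 0.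
  apply: (H (n.+1 * n.+1)%N) => s s' x _ _.
  by rewrite leqNgt ltn_ord.
elim: l => [|l IH] {}f agree f0; apply/eqP/negPn/negP => fN0.
  have [s sf _] := msupp_argmax ord0 fN0.
  have := f0 (const_mx 1); rewrite eval_mxE (bigD1_seq s) //=.
  rewrite [X in _ + X]big_seq_cond [X in _ + X]big1; last first.
    move=> s' /andP[s'f /negP[]].
    by apply/eqP/mnmP => x; apply: agree.
  rewrite addr0 big1 => [|i _]; last by rewrite big1 // => j _; rewrite mxE expr1n.
  by rewrite mulr1 => /eqP; rewrite mcoeff_eq0 sf.
have [lN|Nl] := ltnP l (n.+1 * n.+1); last first.
  move/negP: fN0; apply; apply/eqP; apply: IH => // s s' x sf s'f lx.
  by have := leq_trans Nl lx; rewrite leqNgt ltn_ord.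
pose x := Ordinal lN; have [s sf smax] := msupp_argmax x fN0.
have xE : x = Ordinal lN by [].
case/mxvec_indexP: x / (x) xE smax => a b xE smax.
suff g0 : degree_part (mxvec_index a b) (s (mxvec_index a b)) f = 0.
  have := mcoeff_degree_part (mxvec_index a b) (s (mxvec_index a b)) f s.
  by rewrite g0 mcoeff0 eqxx => /esym/eqP; rewrite mcoeff_eq0 sf.
apply: IH => [s1 s2 x /msupp_degree_part[s1f e1] /msupp_degree_part[s2f e2]|M].
  rewrite leq_eqVlt => /orP[/eqP lx|]; last exact: agree.
  by rewrite (_ : x = mxvec_index a b) ?e1 ?e2 // xE; apply: val_inj.
have := @top_degree_vanish C n.+1 (map_mx (@polyC C) M) f a b
  (s (mxvec_index a b)) 1 (oner_neq0 _) smax (fun t _ _ => f0 _).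
congr (_ = _); congr eval_mx; apply/matrixP => i j.
by rewrite !mxE hornerC.
Qed.

Definition expo s i j := s (mxvec_index i j).

(** [chain e m k]: there are rows 1 <= b_0 < ... < b_(k-1) <= m with
    [e b_c c > 0] for all [c < k], that is, the diagonal term of a minor in the
    columns [0, ..., k-1] divides the monomial with exponents [e].  Row 0 never
    takes part.  The recursion follows the induction in [standard_vanish]; the
    witnesses are recovered in [chainP]. *)
Fixpoint chain (e : 'I_n.+1 -> 'I_n.+1 -> nat) (m k : nat) : bool :=
  match m, k with
  | _, 0 => true
  | 0, _.+1 => false
  | m'.+1, k'.+1 => chain e m' k ||
     (0 < e (inord m) (inord k'))%N && chain e m' k'
  end.

Definition standard (a m k : nat) s : bool :=
  ~~ chain (expo s) m k.+1 &&
  [forall j : 'I_n.+1, (j < a)%N ==> (expo s (inord m) j == 0%N)].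

(** A linear combination, and not only a linear dependence of the columns: this
    makes the locus the image of an affine space, hence irreducible.  Row 0 is
    exempt because the minors generating [K] avoid it. *)
Definition degeneracy_locus (a m k : nat) : set 'M[C]_n.+1 :=
  [set M | (forall j, (j < a)%N -> M (inord m) j = 0) /\
    exists l : 'I_n.+1 -> C, forall i, (0 < i <= m)%N ->
      M i (inord k) = \sum_(j < n.+1 | (j < k)%N) l j * M i j].

Lemma chain0 e m : chain e m 0. Proof. by case: m. Qed.

Lemma standardP a m k s : reflect
  (~~ chain (expo s) m k.+1 /\ forall j, (j < a)%N -> expo s (inord m) j = 0%N)
  (standard a m k s).
Proof.
apply: (iffP andP) => -[sc s0]; split=> //.
  by move=> j ja; apply/eqP; have /forallP/(_ j)/implyP := s0; apply.
by apply/forallP => j; apply/implyP => /s0->.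
Qed.

Lemma inord_neq_lt k j : (k <= n)%N -> (j < k)%N -> (j == inord k) = false.
Proof.
move=> kn jk; apply/eqP => /(congr1 val) /=; rewrite inordK ?ltnS // => jE.
by rewrite jE ltnn in jk.
Qed.

Lemma sum_lt_recr (k : nat) (F : 'I_n.+1 -> C) : (k <= n)%N ->
  \sum_(j < n.+1 | (j < k.+1)%N) F j =
  \sum_(j < n.+1 | (j < k)%N) F j + F (inord k).
Proof.
move=> kn; rewrite (bigD1 (inord k)) /= ?inordK // addrC; congr (_ + _).
apply: eq_bigl => j; rewrite ltnS [in RHS]ltn_neqAle andbC; congr andb.
by rewrite -val_eqE /= inordK.
Qed.

(** Induction on the number [m] of rows; let [z] be the entry of row [m] in
    column [k], and [D] the degree of [f] in it.  If [D > 0], the terms of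
    degree [D] are standard for [m - 1] rows and one column less, and vanish on
    the corresponding locus because that locus is a limit of points of the
    given one with [z] tending to infinity; so they are zero.  If [D = 0], then
    [z] can be chosen freely, so that row [m] imposes no condition on [f]. *)
Lemma standard_vanish m k a f : (m <= n)%N -> (k <= n)%N -> (a < k)%N || (a == 0%N) ->
  (forall s, s \in msupp f -> standard a m k s) ->
  (forall M, degeneracy_locus a m k M -> eval_mx M f = 0) -> f = 0.
Proof.
elim: m k a f => [|m IH] k a f mn kn ak fstd f0.
  apply: eval_mx_inj0 => M.
  pose M' : 'M_n.+1 := \matrix_(i, j)
    if (i == inord 0) && (j < a)%N then 0 else M i j.
  rewrite -(f0 M').
    apply: eval_mx_eq => s i j sf; rewrite mxE.
    case: ifP => // /andP[/eqP-> ja].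
    by have /standardP[_ /(_ j ja)] := fstd s sf; rewrite /expo => ->.
  split=> [j ja|]; first by rewrite mxE eqxx ja.
  by exists (fun=> 0) => i; case: (val i).
set r := inord m.+1 : 'I_n.+1; set c := inord k : 'I_n.+1.
have rE : r = m.+1 :> nat by rewrite inordK.
have cE : c = k :> nat by rewrite inordK.
have rlt i : (i <= m)%N -> (i == r) = false.
  by move=> im; apply/eqP => ir; move: im; rewrite ir rE ltnn.
(* [f] does not involve the variables that vanish on the locus. *)
pose zap M : 'M[C]_n.+1 := \matrix_(i, j)
    if (i == r) && (j < a)%N then 0 else M i j.
have zapE M i j : (i <= m)%N -> zap M i j = M i j.
  by move=> im; rewrite mxE rlt.
have zap_eval M g : {subset msupp g <= msupp f} ->
    eval_mx (zap M) g = eval_mx M g.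
  move=> gf; apply: eval_mx_eq => s i j /gf sf; rewrite mxE.
  case: ifP => // /andP[/eqP-> ja].
  by have /standardP[_ /(_ j ja)] := fstd s sf; rewrite /expo => ->.
apply/eqP/negPn/negP => fN0.
have [s0 s0f smax] := msupp_argmax (mxvec_index r c) fN0.
have [D0|Dpos] := posnP (s0 (mxvec_index r c)).
  move/negP: fN0; apply; apply/eqP; apply: (IH k 0%N); rewrite ?orbT ?(ltnW mn) //.
    move=> s sf; have /standardP[/=] := fstd s sf.
    rewrite negb_or => /andP[sc _] _.
    by apply/standardP.
  move=> M [_ [l Ml]].
  pose v := \sum_(j < n.+1 | (j < k)%N) l j * zap M r j.
  rewrite -(zap_eval M) // -(f0 (set_entry (zap M) r c v)).
    apply: eval_mx_eq => s i j sf sij; rewrite [RHS]mxE.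
    case: ifP => // /andP[/eqP ir /eqP jc]; move: sij (smax s sf).
    by rewrite ir jc D0 leqn0 => /negPf->.
  split=> [j ja|].
    rewrite mxE eqxx /= inord_neq_lt // 1?mxE ?eqxx ?ja //.
    by case/orP: ak => [/(leq_trans _)->//|/eqP a0]; rewrite ?a0 // in ja;
      apply: leq_trans ja _.
  exists l => i /andP[i0]; rewrite leq_eqVlt => /orP[/eqP ir|im].
    have {}ir : i = r by apply: val_inj; rewrite /= ir rE.
    rewrite ir mxE !eqxx /=; apply: eq_bigr => j jk.
    by rewrite [in RHS]mxE eqxx inord_neq_lt.
  rewrite mxE rlt //= zapE // Ml ?i0 //; apply: eq_bigr => j jk.
  by rewrite [in RHS]mxE rlt // zapE.
case: k kn ak fstd f0 @c cE smax Dpos => [|k] kn ak fstd f0 c cE smax Dpos.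
  have /standardP[/=] := fstd s0 s0f.
  by rewrite /expo Dpos chain0 orbT.
have {}ak : (a <= k)%N by case/orP: ak => // /eqP->.
set D := s0 _ in smax Dpos.
suff g0 : degree_part (mxvec_index r c) D f = 0.
  have := mcoeff_degree_part (mxvec_index r c) D f s0.
  by rewrite g0 mcoeff0 eqxx => /esym/eqP; rewrite mcoeff_eq0 s0f.
have gf : {subset msupp (degree_part (mxvec_index r c) D f) <= msupp f}.
  by move=> s /msupp_degree_part[].
apply: (IH k 0%N); rewrite ?orbT ?(ltnW mn) ?(ltnW kn) //.
  move=> s /msupp_degree_part[sf sD]; have /standardP[/=] := fstd s sf.
  rewrite /expo sD Dpos /= negb_or => /andP[_ sc] _.
  by apply/standardP.
move=> M [_ [l Ml]]; rewrite -zap_eval //; set N := zap M.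
pose d := inord k : 'I_n.+1.
have dE : d = k :> nat by rewrite inordK // ltnS ltnW.
pose v := \sum_(j < n.+1 | (j < k)%N) l j * N r j.
(* The degeneration below divides by [v - u], so the entry in row [r] and
   column [d] is first moved away from [v]. *)
pose Pu : 'M[{poly C}]_n.+1 := set_entry (map_mx (@polyC C) N) r d 'X.
have PuE u : curve_at Pu u = set_entry N r d u.
  by apply/matrixP => i j; rewrite !mxE; case: ifP; rewrite ?hornerX ?hornerC.
have -> : N = curve_at Pu (N r d).
  rewrite PuE; apply/matrixP => i j; rewrite [RHS]mxE.
  by case: ifP => // /andP[/eqP-> /eqP->].
apply: (@curve_vanish _ _ _ _ (v%:P - 'X)).
  by rewrite -opprB oppr_eq0 polyXsubC_eq0.
move=> u; rewrite PuE !hornerE => vu.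
set W := set_entry N r d u.
(* Multiples of column [c] are added to the columns before it, in proportion to
   the entries of row [r].  The relation between the columns up to [d] of [W]
   then yields column [c] times the non-zero factor [t * (v - u)], also in row
   [r], where the entry of column [c] is [t^-1]. *)
pose Ps : 'M[{poly C}]_n.+1 := \matrix_(i, j)
  if (i <= m)%N && (j <= k)%N then (W i j)%:P + (W i c * W r j) *: 'X
  else (W i j)%:P.
have PsE t : curve_at Ps t = \matrix_(i, j)
    if (i <= m)%N && (j <= k)%N then W i j + t * (W i c * W r j) else W i j.
  apply/matrixP => i j; rewrite [LHS]mxE [Ps _ _]mxE [RHS]mxE.
  by case: ifP => _; rewrite ?hornerE //=; congr (_ + _); rewrite mulrC mulrA.
have -> : W = curve_at Ps 0.
  by rewrite PsE; apply/matrixP => i j; rewrite [RHS]mxE mul0r addr0 if_same.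
apply: (@top_degree_vanish _ _ _ _ _ _ _ 1) => //; first exact: oner_neq0.
move=> t t0 _; apply: f0; rewrite PsE.
have Wr j : (j < k)%N -> W r j = N r j.
  by move=> jk; rewrite mxE eqxx /= inord_neq_lt // ltnW.
have Wm i j : (i <= m)%N -> W i j = N i j by move=> im; rewrite mxE rlt.
split=> [j ja|].
  rewrite mxE eqxx /= inord_neq_lt //; last by rewrite ltnS (leq_trans (ltnW ja)).
  rewrite mxE rE ltnn /= Wr; last exact: leq_trans ja ak.
  by rewrite mxE eqxx ja.
(* All terms of the relation are moved to one side, column [d] included. *)
pose nu j := if j == d then -1 else l j.
have nuE (F : 'I_n.+1 -> C) : \sum_(j < n.+1 | (j < k.+1)%N) nu j * F j =
    \sum_(j < n.+1 | (j < k)%N) l j * F j - F d.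
  rewrite sum_lt_recr 1?ltnW // /nu eqxx mulN1r; congr (_ - _).
  by apply: eq_bigr => j jk; rewrite inord_neq_lt // ltnW.
have SE : \sum_(j < n.+1 | (j < k.+1)%N) nu j * W r j = v - u.
  rewrite nuE; congr (_ - _); last by rewrite mxE !eqxx.
  by apply: eq_bigr => j /Wr->.
exists (fun j => (t * (v - u))^-1 * nu j) => i /andP[i0].
have split_sum (F : 'I_n.+1 -> C) :
    \sum_(j < n.+1 | (j < k.+1)%N) (t * (v - u))^-1 * nu j * F j =
    (t * (v - u))^-1 * (\sum_(j < n.+1 | (j < k.+1)%N) nu j * F j).
  by rewrite mulr_sumr; apply: eq_bigr => j _; rewrite mulrA.
rewrite split_sum leq_eqVlt => /orP[/eqP ir|im].
  have {}ir : i = r by apply: val_inj; rewrite /= ir rE.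
  rewrite ir mxE !eqxx /=.
  under eq_bigr => j jk do rewrite mxE eqxx /= inord_neq_lt // mxE rE ltnn /=.
  by rewrite SE invfM mulfVK // -mulrA mulVf ?mulr1.
rewrite ltnS in im; rewrite mxE rlt //= mxE im cE ltnn /=.
under eq_bigr => j jk do rewrite mxE rlt //= mxE im -ltnS jk /= mulrDr.
rewrite big_split /=.
have -> : \sum_(j < n.+1 | (j < k.+1)%N) nu j * W i j = 0.
  rewrite nuE Wm // zapE // Ml ?i0 //; apply/eqP; rewrite subr_eq0; apply/eqP.
  by apply: eq_bigr => j jk; rewrite Wm // zapE.
rewrite add0r.
have -> : \sum_(j < n.+1 | (j < k.+1)%N) nu j * (t * (W i c * W r j)) =
    W i c * (t * (v - u)).
  rewrite -SE !mulr_sumr; apply: eq_bigr => j _.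
  by rewrite [RHS]mulrCA [LHS]mulrCA; congr (_ * _); rewrite mulrCA.
by rewrite mulrCA mulVf ?mulr1 // mulf_neq0.
Qed.

End StandardMonomials.

(** * Ideals *)

Section IdealTools.
Variable A : comNzRingType.
Implicit Types (I J : set A) (G : set A).

Definition is_ideal I : Prop :=
  [/\ I 0, forall x y, I x -> I y -> I (x + y) & forall c x, I x -> I (c * x)].

Lemma is_ideal_opp I x : is_ideal I -> I x -> I (- x).
Proof. by move=> [_ _ IM] Ix; rewrite -mulN1r; apply: IM. Qed.

Lemma is_ideal_sub I x y : is_ideal I -> I x -> I y -> I (x - y).
Proof.
by move=> iI Ix Iy; case: (iI) => _ ID _; apply: ID => //; apply: is_ideal_opp.
Qed.

Lemma is_ideal_sum I (T : eqType) (r : seq T) (P : pred T) (F : T -> A) :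
  is_ideal I -> (forall i, i \in r -> P i -> I (F i)) -> I (\sum_(i <- r | P i) F i).
Proof.
move=> [I0 ID _] IF; rewrite big_seq_cond; apply: (big_ind I) => // i.
by case/andP; apply: IF.
Qed.

Lemma ideal_gen_is_ideal G : is_ideal (ideal_gen G).
Proof.
split.
- by exists [::]; rewrite big_nil.
- move=> x y [r [Gr ->]] [s [Gs ->]]; exists (r ++ s); rewrite big_cat.
  by split=> // p; rewrite mem_cat => /orP[/Gr|/Gs].
- move=> c x [r [Gr ->]]; exists [seq (c * p.1, p.2) | p <- r]; split.
    by move=> p /mapP[q /Gr Gq ->].
  by rewrite big_map mulr_sumr; apply: eq_bigr => p _; rewrite mulrA.
Qed.

Lemma ideal_gen_mem G x : G x -> ideal_gen G x.
Proof.
move=> Gx; exists [:: (1, x)]; rewrite big_seq1 mul1r.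
by split=> // p; rewrite inE => /eqP->.
Qed.

Lemma ideal_gen_sub G I : is_ideal I -> G `<=` I -> ideal_gen G `<=` I.
Proof.
move=> iI GI x [s [Gs ->]]; apply: is_ideal_sum => // p /Gs Gp _.
by case: iI => _ _; apply; apply: GI.
Qed.

Lemma ideal_add_is_ideal I J : is_ideal I -> is_ideal J -> is_ideal (ideal_add I J).
Proof.
move=> [I0 ID IM] [J0 JD JM]; split.
- by exists 0 => //; exists 0; rewrite // addr0.
- move=> x y [a Ia [b Jb ->]] [c Ic [d Jd ->]].
  by exists (a + c); [exact: ID | exists (b + d); [exact: JD | rewrite addrACA]].
- move=> c x [a Ia [b Jb ->]].
  by exists (c * a); [exact: IM | exists (c * b); [exact: JM | rewrite mulrDr]].
Qed.

Lemma ideal_add_subl I J : is_ideal J -> I `<=` ideal_add I J.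
Proof. by move=> [J0 _ _] x Ix; exists x => //; exists 0; rewrite ?addr0. Qed.

Lemma ideal_add_subr I J : is_ideal I -> J `<=` ideal_add I J.
Proof. by move=> [I0 _ _] x Jx; exists 0 => //; exists x; rewrite ?add0r. Qed.

Lemma ideal_add_sub I J K : is_ideal K -> I `<=` K -> J `<=` K ->
  ideal_add I J `<=` K.
Proof. by move=> [_ KD _] IK JK x [a Ia [b Jb ->]]; apply: KD; auto. Qed.

Lemma ideal_sum_is_ideal (T : finType) (I : T -> set A) :
  (forall i, is_ideal (I i)) -> is_ideal (ideal_sum I).
Proof.
move=> iI; split.
- exists (fun=> 0); split; last by rewrite big1.
  by move=> i; case: (iI i).
- move=> x y [f [If ->]] [g [Ig ->]]; exists (fun i => f i + g i).
  by rewrite big_split; split=> // i; case: (iI i) => _ + _; apply.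
- move=> c x [f [If ->]]; exists (fun i => c * f i); rewrite mulr_sumr.
  by split=> // i; case: (iI i) => _ _; apply.
Qed.

Lemma ideal_sum_mem (T : finType) (I : T -> set A) i x :
  (forall i, I i 0) -> I i x -> ideal_sum I x.
Proof.
move=> I0 Ix; exists (fun j => if j == i then x else 0); split.
  by move=> j; case: eqP => // ->.
by rewrite -big_mkcond big_pred1_eq.
Qed.

Lemma ideal_sum_sub (T : finType) (I : T -> set A) K : is_ideal K ->
  (forall i, I i `<=` K) -> ideal_sum I `<=` K.
Proof. by move=> iK IK x [g [Ig ->]]; apply: is_ideal_sum => // i _ _; apply: IK. Qed.

End IdealTools.

(** * Diagonal terms of minors *)

Section Weights.

(** The digits of a number in base [N] below position [b j] do not add up to
    [N ^ b j]. *)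
Lemma geometric_bound (N k : nat) (b : nat -> nat) (j : nat) : (k < N)%N ->
  (forall c d, (c < d <= k)%N -> (b c < b d)%N) -> (j <= k)%N ->
  (\sum_(c < j) k * N ^ b c < N ^ b j)%N.
Proof.
move=> kN b_incr; have N0 : (0 < N)%N by case: N kN.
elim: j => [|j IH] jk; first by rewrite big_ord0 expn_gt0 N0.
rewrite big_ord_recr /=.
apply: (@leq_trans (N ^ (b j).+1)); last first.
  by rewrite leq_pexp2l // b_incr // leqnn.
rewrite expnS; apply: (@leq_trans (k.+1 * N ^ b j)).
  by rewrite mulSn -addSn leq_add2r IH // ltnW.
by rewrite leq_mul2r kN orbT.
Qed.

(** Numbers in base [N] are compared at their highest different digit: here it
    belongs to the largest point moved by [s], where [s] must decrease. *)
Lemma perm_weight_lt (N k : nat) (b : nat -> nat) (s : 'S_k.+1) : (k < N)%N ->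
  (forall c d, (c < d <= k)%N -> (b c < b d)%N) -> s != 1%g ->
  (\sum_(c < k.+1) s c * N ^ b c < \sum_(c < k.+1) c * N ^ b c)%N.
Proof.
move=> kN b_incr s1.
have [c0 c0s] : exists c, s c != c.
  apply/existsP; rewrite -negb_forall; apply: contra s1 => /forallP sE.
  by apply/eqP/permP => c; rewrite perm1; apply/eqP.
have [j sj jmax] :=
  @arg_maxnP _ c0 (fun c => s c != c) (fun c : 'I_k.+1 => c : nat) c0s.
have fixed (c : 'I_k.+1) : (j < c)%N -> s c = c.
  move=> jc; apply/eqP/negPn/negP => /jmax /=.
  by rewrite leqNgt jc.
have sjj : (s j < j)%N.
  rewrite ltn_neqAle; case: (ltngtP (s j) j) => //= [js|/val_inj E].
    by move: sj; rewrite -(inj_eq (@perm_inj _ s)) fixed // eqxx.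
  by rewrite E eqxx in sj.
rewrite (bigID (fun c : 'I_k.+1 => (c < j)%N)) /=.
rewrite [X in (_ < X)%N](bigID (fun c : 'I_k.+1 => (c < j)%N)) /=.
rewrite [X in (_ + X < _)%N](bigD1 j) ?ltnn //=.
rewrite [X in (_ < _ + X)%N](bigD1 j) ?ltnn //=.
set F := (\sum_(c < k.+1 | (c < j)%N) s c * _)%N.
set G := (\sum_(c < k.+1 | (c < j)%N) c * _)%N.
rewrite [X in (_ + X < _)%N]addnC [X in (_ < _ + X)%N]addnC.
rewrite (eq_bigr (fun c : 'I_k.+1 => c * N ^ b c)%N); last first.
  move=> c /andP[cj cNj]; rewrite fixed // ltn_neqAle leqNgt cj andbT.
  by rewrite eq_sym.
set H := (\sum_(c < k.+1 | _) _)%N.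
suff lt : (F + s j * N ^ b j < j * N ^ b j)%N.
  rewrite addnCA [X in (_ < X)%N]addnCA ltn_add2l.
  exact: leq_trans lt (leq_addl _ _).
have jk : (j <= k)%N by rewrite -ltnS.
apply: (@leq_trans ((s j).+1 * N ^ b j)); last by rewrite leq_mul2r sjj orbT.
rewrite mulSn -addSn leq_add2r.
apply: leq_ltn_trans (geometric_bound kN b_incr jk).
rewrite /F (big_ord_narrow (ltnW (ltn_ord j))) /=.
by apply: leq_sum => c _; rewrite leq_mul2r -ltnS ltn_ord orbT.
Qed.

End Weights.

(** * Standard monomials span *)

Section Spanning.
Variables (C : numFieldType) (n : nat).
Implicit Types (f g : coord_ring C n.+1) (M : 'M[C]_n.+1).
Implicit Types (s : 'X_{1..n.+1 * n.+1}) (i j k : 'I_n.+1).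

Lemma chainP (e : 'I_n.+1 -> 'I_n.+1 -> nat) (m k : nat) : chain e m k -> (m <= n)%N ->
  exists B : nat -> 'I_n.+1,
    (forall c, (c < k)%N -> (0 < B c <= m)%N /\ (0 < e (B c) (inord c))%N) /\
    (forall c d, (c < d < k)%N -> (B c < B d)%N).
Proof.
case: k => [|k].
  by exists (fun=> ord0); split=> // c d; rewrite ltn0 andbF.
elim: m k => // m IH k /=.
move=> ch mn; case/orP: ch => [/IH/(_ (ltnW mn))[B [Bm Bincr]]|].
  exists B; split=> // c /Bm[/andP[-> Bcm] ec].
  by split=> //; apply: leq_trans Bcm _.
case/andP => e0 ch.
have [B [Bm Bincr]] : exists B : nat -> 'I_n.+1,
    (forall c, (c < k)%N -> (0 < B c <= m)%N /\ (0 < e (B c) (inord c))%N) /\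
    (forall c d, (c < d < k)%N -> (B c < B d)%N).
  case: k ch {e0} => [|k /IH]; last by apply; apply: ltnW.
  by exists (fun=> ord0); split=> // c d; rewrite ltn0 andbF.
exists (fun c => if c == k then inord m.+1 else B c); split=> c.
  rewrite ltnS leq_eqVlt; case: eqP => [-> _|_ /= /Bm[/andP[-> Bcm] ec]].
    by rewrite inordK // leqnn.
  by split=> //; apply: leq_trans Bcm _.
move=> d /andP[cd]; rewrite ltnS leq_eqVlt.
case: (d =P k) => [dk _|_ /= dk]; last first.
  by rewrite ltn_eqF ?(ltn_trans cd) // Bincr // cd.
rewrite dk in cd; rewrite ltn_eqF // inordK // ltnS.
by have [/andP[]] := Bm c cd.
Qed.

Lemma mxvec_index_inj i j i' j' :
  mxvec_index i j = mxvec_index i' j' -> i = i' /\ j = j'.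
Proof. by move=> /cast_ord_inj /enum_rank_inj [-> ->]. Qed.

Definition JK_ideal (a : nat) k : set (coord_ring C n.+1) :=
  ideal_add (@ideal_J0 C n.+1 a) (ideal_K k).

Lemma J0_is_ideal a : is_ideal (@ideal_J0 C n.+1 a).
Proof. exact: ideal_gen_is_ideal. Qed.

Lemma K_is_ideal k : is_ideal (@ideal_K C _ k).
Proof. exact: ideal_gen_is_ideal. Qed.

Lemma JK_is_ideal a k : is_ideal (JK_ideal a k).
Proof. by apply: ideal_add_is_ideal; [exact: J0_is_ideal | exact: K_is_ideal]. Qed.

Lemma J0_var (a : nat) j : (j < a)%N ->
  @ideal_J0 C n.+1 a (generic_mx C n.+1 ord_max j).
Proof. by move=> ja; apply: ideal_gen_mem; exists ord_max, j. Qed.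

Definition minor_poly k (B : 'I_k.+1 -> 'I_n.+1) : coord_ring C n.+1 :=
  \det (mxsub B (widen_ord (ltn_ord k)) (generic_mx C n.+1)).

Lemma K_minor k (B : 'I_k.+1 -> 'I_n.+1) : increasing B -> (forall c, (0 < B c)%N) ->
  ideal_K k (minor_poly B).
Proof. by move=> Bincr B0; apply: ideal_gen_mem; exists B. Qed.

Lemma eval_generic M i j : eval_mx M (generic_mx C n.+1 i j) = M i j.
Proof. by rewrite /eval_mx mxE mevalXU mxvecE. Qed.

Lemma eval_minor M k (B : 'I_k.+1 -> 'I_n.+1) :
  eval_mx M (minor_poly B) = \det (mxsub B (widen_ord (ltn_ord k)) M).
Proof.
rewrite /eval_mx /minor_poly -det_map_mx; congr (\det _); apply/matrixP => i j.
rewrite [LHS]mxE [RHS]mxE -eval_generic.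
by rewrite /eval_mx; congr (meval _ _); rewrite [LHS]mxE.
Qed.

(** The relation between the columns up to [b] is a kernel vector of the
    submatrix. *)
Lemma det_degenerate a (b : nat) k (B : 'I_k.+1 -> 'I_n.+1) M : (b <= k)%N ->
  (forall c, (0 < B c)%N) ->
  degeneracy_locus a n b M -> \det (mxsub B (widen_ord (ltn_ord k)) M) = 0.
Proof.
move=> bk B0 [_ [l Ml]]; apply/eqP; rewrite -det_tr; apply/det0P.
have bn : (b <= n)%N by apply: leq_trans bk _; rewrite -ltnS.
pose nu j := if j == inord b :> 'I_n.+1 then -1 else if (j < b)%N then l j else 0.
exists (\row_c nu (widen_ord (ltn_ord k) c)).
  apply/eqP => /rowP /(_ (inord b)); rewrite !mxE /nu.
  have -> : widen_ord (ltn_ord k) (inord b) = inord b.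
    by apply: val_inj; rewrite /= !inordK.
  by rewrite eqxx => /eqP; rewrite oppr_eq0 oner_eq0.
apply/rowP => x; rewrite !mxE.
transitivity (\sum_(j < n.+1 | (j < k.+1)%N) nu j * M (B x) j).
  by rewrite (big_ord_narrow (ltn_ord k)); apply: eq_bigr => c _; rewrite !mxE.
transitivity (\sum_(j < n.+1 | (j < b.+1)%N) nu j * M (B x) j).
  rewrite big_mkcond [RHS]big_mkcond; apply: eq_bigr => j _.
  rewrite /nu -val_eqE /= inordK // !ltnS [in RHS]leq_eqVlt.
  case: eqP => [->|_]; first by rewrite bk.
  by case: ltnP => [/ltnW/leq_trans->|]; rewrite ?mul0r ?if_same.
rewrite sum_lt_recr // {2}/nu eqxx mulN1r Ml; last by rewrite B0 -ltnS ltn_ord.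
apply/eqP; rewrite subr_eq0; apply/eqP; apply: eq_bigr => j jb.
by rewrite /nu inord_neq_lt ?jb.
Qed.

Lemma vanishing_is_ideal (S : set 'M[C]_n.+1) : is_ideal (vanishing_ideal S).
Proof.
split=> [M SM|x y Ix Iy M SM|c x Ix M SM]; first by rewrite /eval_mx meval0.
  by rewrite /eval_mx mevalD -/(eval_mx M x) Ix // add0r; exact: Iy.
by rewrite /eval_mx mevalM [X in _ * X](Ix M SM) mulr0.
Qed.

Lemma JK_sub_vanishing a k : JK_ideal a k `<=` vanishing_ideal (degeneracy_locus a n k).
Proof.
apply: ideal_add_sub; first exact: vanishing_is_ideal.
  apply: ideal_gen_sub => [|f [i [j [iE ja ->]]] M [Ma _]].
    exact: vanishing_is_ideal.
  rewrite eval_generic (_ : i = inord n) ?Ma //.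
  by apply: val_inj; rewrite /= inordK //; case: iE.
apply: ideal_gen_sub => [|f [B [Bincr B0 ->]] M SM]; first exact: vanishing_is_ideal.
by rewrite [LHS]eval_minor; apply: det_degenerate SM.
Qed.

(** A weight for which the diagonal is the unique heaviest term of every minor:
    column indices are the digits, row indices the positions, and the base
    [n.+2] exceeds every column index. *)
Definition mweight s : nat :=
  (\sum_i \sum_j s (mxvec_index i j) * (j * n.+2 ^ i))%N.

Lemma mweightD s t : mweight (s + t)%MM = (mweight s + mweight t)%N.
Proof.
rewrite /mweight -big_split; apply: eq_bigr => i _ /=; rewrite -big_split.
by apply: eq_bigr => j _ /=; rewrite mnmDE mulnDl.
Qed.

Lemma mweightU i j : mweight U_(mxvec_index i j)%MM = (j * n.+2 ^ i)%N.
Proof.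
rewrite /mweight pair_big (bigD1 (i, j)) //= mnm1E eqxx mul1n big1 ?addn0 //.
move=> [i' j'] /= ne; rewrite mnm1E; case: eqP => // /mxvec_index_inj[ei ej].
by rewrite ei ej eqxx in ne.
Qed.

Lemma mweight_sum (T : Type) (r : seq T) (F : T -> 'X_{1..n.+1 * n.+1}) :
  mweight (\sum_(x <- r) F x)%MM = (\sum_(x <- r) mweight (F x))%N.
Proof.
apply: (big_morph mweight mweightD).
by rewrite /mweight big1 // => i _; rewrite big1 // => j _; rewrite mnm0E.
Qed.

(** The exponent of the term of the minor [minor_poly B] given by [t]. *)
Definition term_exp k (B : 'I_k.+1 -> 'I_n.+1) (t : 'S_k.+1) : 'X_{1..n.+1 * n.+1} :=
  (\sum_(c < k.+1) U_(mxvec_index (B c) (widen_ord (ltn_ord k) (t c))))%MM.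

Lemma minor_polyE k (B : 'I_k.+1 -> 'I_n.+1) :
  minor_poly B = \sum_(t : 'S_k.+1) (-1) ^+ t *: 'X_[term_exp B t].
Proof.
apply: eq_bigr => t _; rewrite -mul_mpolyC rmorphXn rmorphN1; congr (_ * _).
rewrite /term_exp (big_morph _ (@mpolyXD _ C) (mpolyX0 _ C)).
by apply: eq_bigr => c _; rewrite !mxE.
Qed.

Definition reducible a k f : Prop :=
  exists2 g, forall s, s \in msupp g -> standard a n k s & JK_ideal a k (f - g).

Lemma reducible_mem a k f : JK_ideal a k f -> reducible a k f.
Proof. by move=> Qf; exists 0; rewrite ?subr0 // => s; rewrite msupp0. Qed.

Lemma reducibleD a k f g : reducible a k f -> reducible a k g -> reducible a k (f + g).
Proof.
move=> [f' f's Qf] [g' g's Qg]; exists (f' + g').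
  by move=> s /msuppD_le; rewrite mem_cat => /orP[/f's|/g's].
by rewrite opprD addrACA; case: (JK_is_ideal a k) => _ QD _; apply: QD.
Qed.

Lemma reducibleZ a k c f : reducible a k f -> reducible a k (c *: f).
Proof.
move=> [f' f's Qf]; exists (c *: f'); first by move=> s /msuppZ_le/f's.
by rewrite -scalerBr -mul_mpolyC; case: (JK_is_ideal a k) => _ _; apply.
Qed.

Lemma reducible_sum a k (T : Type) (r : seq T) (P : pred T)
    (F : T -> coord_ring C n.+1) :
  (forall x, P x -> reducible a k (F x)) -> reducible a k (\sum_(x <- r | P x) F x).
Proof.
move=> PF; apply: (big_ind (reducible a k)) => //; last exact: reducibleD.
by apply: reducible_mem; case: (JK_is_ideal a k).
Qed.

Lemma monomial_dvd s t : (t <= s)%MM ->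
  'X_[C, s] = 'X_[(s - t)%MM] * 'X_[t].
Proof. by move=> ts; rewrite -mpolyXD submK. Qed.

Lemma term_exp1_le k (B : 'I_k.+1 -> 'I_n.+1) s : injective B ->
  (forall c, (0 < expo s (B c) (widen_ord (ltn_ord k) c))%N) ->
  (term_exp B 1 <= s)%MM.
Proof.
move=> B_inj s0; apply/mnm_lepP => x; rewrite /term_exp mnm_sumE.
have [c /eqP cx|no] :=
  pickP (fun c => mxvec_index (B c) (widen_ord (ltn_ord k) c) == x).
  rewrite (bigD1 c) //= mnm1E perm1 cx eqxx big1 ?addn0.
    by rewrite -cx; exact: s0.
  move=> d dc; rewrite mnm1E perm1 -cx; case: eqP => // /mxvec_index_inj[/B_inj dE].
  by rewrite dE eqxx in dc.
by rewrite big1 // => c _; rewrite mnm1E perm1 no.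
Qed.

Lemma mweight_term_exp k (B : 'I_k.+1 -> 'I_n.+1) (t : 'S_k.+1) :
  mweight (term_exp B t) = (\sum_(c < k.+1) t c * n.+2 ^ B c)%N.
Proof. by rewrite mweight_sum; apply: eq_bigr => c _; rewrite mweightU. Qed.

(** Induction on the weight: a monomial divisible by a diagonal is, modulo the
    minor, a combination of lighter monomials. *)
Lemma monomial_reducible a k s : reducible a k 'X_[s].
Proof.
have [w] := ubnP (mweight s); elim: w s => // w IH s sw.
have [std|] := boolP (standard a n k s).
  exists 'X_[s]; first by move=> s'; rewrite msuppX inE => /eqP->.
  by rewrite subrr; case: (JK_is_ideal a k).
rewrite negb_and negbK => /orP[|]; last first.
  rewrite negb_forall => /existsP[j]; rewrite negb_imply => /andP[ja sj].
  apply: reducible_mem; rewrite (@monomial_dvd s U_(mxvec_index ord_max j)%MM).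
    apply: ideal_add_subl; first exact: K_is_ideal.
    case: (J0_is_ideal a) => _ _; apply.
    by have := J0_var ja; rewrite mxE.
  apply/mnm_lepP => x; rewrite mnm1E; case: eqP => // <-.
  by move: sj; rewrite /expo (_ : inord n = ord_max) ?lt0n //; apply: val_inj;
     rewrite /= inordK.
case/chainP => // B [Bn Bincr].
pose Bo (c : 'I_k.+1) := B c.
have Bo_incr : increasing Bo by move=> c d cd; apply: Bincr; rewrite cd ltn_ord.
have Bo_inj : injective Bo.
  move=> c d Bcd; apply: val_inj => /=; case: (ltngtP c d) => // /Bo_incr;
  by rewrite Bcd ltnn.
have ds : (term_exp Bo 1 <= s)%MM.
  apply: term_exp1_le => // c; have [_] := Bn c (ltn_ord c).
  by congr (0 < expo s _ _)%N; apply: val_inj;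
     rewrite /= inordK // (leq_trans (ltn_ord c)).
(* Solve the expansion of the minor for its diagonal term. *)
set s' := (s - term_exp Bo 1)%MM.
have -> : 'X_[s] = 'X_[s'] * minor_poly Bo +
    \sum_(t : 'S_k.+1 | t != 1%g) (- (-1) ^+ t) *: 'X_[C, s' + term_exp Bo t].
  rewrite minor_polyE (bigD1 1%g) //= odd_perm1 expr0 scale1r mulrDr -monomial_dvd //.
  rewrite -addrA mulr_sumr -big_split big1 ?addr0 // => t _ /=.
  by rewrite mpolyXD scaleNr -scalerAr subrr.
apply: reducibleD.
  apply: reducible_mem; apply: ideal_add_subr; first exact: J0_is_ideal.
  case: (K_is_ideal k) => _ _; apply; apply: K_minor => // c.
  by have [/andP[]] := Bn c (ltn_ord c).
apply: reducible_sum => t t1; apply: reducibleZ; apply: IH.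
rewrite ltnS in sw; apply: leq_trans sw.
rewrite -[in X in (_ < X)%N](submK ds) -/s' !mweightD ltn_add2l.
rewrite !mweight_term_exp.
under [X in (_ < X)%N]eq_bigr => c _ do rewrite perm1.
apply: (@perm_weight_lt n.+2 k (fun c => B c : nat)) => //.
by rewrite (ltn_trans (ltn_ord k)).
Qed.

Lemma all_reducible a k f : reducible a k f.
Proof.
rewrite [f]mpolyE; apply: reducible_sum => s _.
by apply: reducibleZ; apply: monomial_reducible.
Qed.

(** Reduce [f] to a combination of standard monomials; that combination still
    vanishes on the locus, so it is zero. *)
Theorem JK_ideal_vanishing a k : (a < k)%N || (a == 0%N) ->
  JK_ideal a k = vanishing_ideal (degeneracy_locus a n k).
Proof.
move=> ak; apply/seteqP; split; first exact: JK_sub_vanishing.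
move=> f f0; have [g gstd Qfg] := all_reducible a k f.
suff g0 : g = 0 by rewrite -(subr0 f) -g0.
apply: (standard_vanish (leqnn n) _ ak gstd); first by rewrite -ltnS.
move=> M SM; rewrite (_ : g = f - (f - g)); last by rewrite opprB addrC subrK.
have := is_ideal_sub (vanishing_is_ideal _) f0 (JK_sub_vanishing Qfg).
exact.
Qed.

End Spanning.

(** * Primality and the intersection of the two kinds of ideals *)

Section Primality.
Variables (C : numFieldType) (n : nat).
Implicit Types (f g : coord_ring C n.+1) (M : 'M[C]_n.+1) (i j k : 'I_n.+1).

(** Join the parameters of the two points by a line; the entries of column [k]
    are then computed from the parameters. *)
Lemma locus_path (a : nat) k M M' : (a < k)%N || (a == 0%N) ->
  degeneracy_locus a n k M -> degeneracy_locus a n k M' ->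
  exists P : 'M[{poly C}]_n.+1, [/\ curve_at P 0 = M, curve_at P 1 = M' &
    forall t, degeneracy_locus a n k (curve_at P t)].
Proof.
move=> ak [M0 [l Ml]] [M0' [l' Ml']].
pose line (x y : C) : {poly C} := x%:P + (y - x) *: 'X.
have lineE x y t : (line x y).[t] = x + (y - x) * t by rewrite !hornerE.
pose P : 'M[{poly C}]_n.+1 := \matrix_(i, j)
  if (0 < i)%N && (j == k)
  then \sum_(j' < n.+1 | (j' < k)%N) line (l j') (l' j') * line (M i j') (M' i j')
  else line (M i j) (M' i j).
have Pcol t i : (0 < i)%N -> (P i k).[t] = \sum_(j' < n.+1 | (j' < k)%N)
    (line (l j') (l' j')).[t] * (line (M i j') (M' i j')).[t].
  move=> i0; rewrite mxE i0 eqxx /= horner_sum.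
  by apply: eq_bigr => j' _; rewrite hornerM.
have PN t i j : ~~ ((0 < i)%N && (j == k)) ->
    (P i j).[t] = (line (M i j) (M' i j)).[t].
  by move=> /negbTE ij; rewrite mxE ij.
have rows i : (0 < i)%N -> (0 < i <= n)%N by move=> ->; rewrite -ltnS /=.
exists P; split.
- apply/matrixP => i j; rewrite mxE.
  have [/andP[i0 /eqP->]|ij] := boolP ((0 < i)%N && (j == k)); last first.
    by rewrite PN // lineE mulr0 addr0.
  have := Ml i (rows _ i0); rewrite inord_val => ->; rewrite Pcol //.
  by apply: eq_bigr => j' _; rewrite !lineE !mulr0 !addr0.
- apply/matrixP => i j; rewrite mxE.
  have [/andP[i0 /eqP->]|ij] := boolP ((0 < i)%N && (j == k)); last first.
    by rewrite PN // lineE mulr1 addrC subrK.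
  have := Ml' i (rows _ i0); rewrite inord_val => ->; rewrite Pcol //.
  by apply: eq_bigr => j' _; rewrite !lineE !mulr1 ![_ + (_ - _)]addrC !subrK.
move=> t; split=> [j ja|].
  rewrite mxE PN ?lineE ?M0 ?M0' // ?subrr ?mul0r ?addr0 //.
  rewrite negb_and -val_eqE /= neq_ltn; case/orP: ak => [/(ltn_trans ja)->|].
    by rewrite orbT.
  by move=> /eqP a0; rewrite a0 in ja.
exists (fun j => (line (l j) (l' j)).[t]) => i /andP[i0 _].
rewrite inord_val mxE Pcol //; apply: eq_bigr => j jk.
by rewrite mxE PN // i0 -val_eqE /= neq_ltn jk.
Qed.

Lemma locus0 a k : degeneracy_locus a n k (0 : 'M[C]_n.+1).
Proof.
split=> [j _|]; first by rewrite mxE.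
by exists (fun=> 0) => i _; rewrite mxE big1 // => j _; rewrite mul0r.
Qed.

Lemma prime_idealP (A : comNzRingType) (I : set A) : is_ideal I -> ~ I 1 ->
  (forall x y, I (x * y) -> I x \/ I y) -> prime_ideal I.
Proof.
move=> [I0 ID IM] I1 IP; split.
  split; first by apply/mem_set.
    by apply/negP => /set_mem.
  move=> c x y /set_mem Ix /set_mem Iy; apply/mem_set.
  by apply: ID => //; apply: IM.
move=> x y /set_mem /IP[Ix|Iy]; apply/orP; [left|right]; exact/mem_set.
Qed.

(** On a curve through a point where [f] does not vanish and one where [g] does
    not, the product is a non-zero polynomial of the parameter. *)
Lemma JK_mul (a : nat) k f g : (a < k)%N || (a == 0%N) ->
  JK_ideal a k (f * g) -> JK_ideal a k f \/ JK_ideal a k g.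
Proof.
move=> ak; rewrite JK_ideal_vanishing // => fg0.
have [f0|nf] := pselect (vanishing_ideal (degeneracy_locus a n k) f); first by left.
right=> M SM; apply: contrapT => gM; apply: nf => M' SM'; apply: contrapT => fM'.
have [P [P0 P1 PS]] := locus_path ak SM SM'.
have : along P f * along P g = 0.
  apply: (@poly_vanish _ _ 1); first exact: oner_neq0.
  move=> t _; rewrite hornerM !along_horner /eval_mx -mevalM.
  exact: fg0 (PS t).
move=> /eqP; rewrite mulf_eq0 => /orP[] /eqP h0; [apply: fM'|apply: gM].
  by rewrite -P1 -along_horner h0 horner0.
by rewrite -P0 -along_horner h0 horner0.
Qed.

Lemma JK_neq1 (a : nat) k : ~ JK_ideal a k (1 : coord_ring C n.+1).
Proof.
move=> /JK_sub_vanishing/(_ _ (locus0 a k)) /eqP.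
by rewrite /eval_mx meval1 oner_eq0.
Qed.

Lemma JK_prime (a : nat) k : (a < k)%N || (a == 0%N) -> prime_ideal (@JK_ideal C n a k).
Proof.
move=> ak; apply: prime_idealP; [exact: JK_is_ideal | exact: JK_neq1 |].
by move=> f g; apply: JK_mul.
Qed.

Lemma J0_0 : @ideal_J0 C n.+1 0 = [set 0].
Proof.
apply/seteqP; split=> [f|f ->]; last by case: (@J0_is_ideal C n 0).
apply: ideal_gen_sub => [|x [i [j []]] //].
by split=> [|x y -> ->|c x ->]; rewrite /= ?addr0 ?mulr0.
Qed.

Lemma J0_split (a : 'I_n.+1) f : @ideal_J0 C n.+1 a.+1 f -> 
  exists f' g, @ideal_J0 C n.+1 a f' /\ f = f' + generic_mx C n.+1 ord_max a * g.
Proof.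
set z := generic_mx C n.+1 ord_max a.
pose D : set (coord_ring C n.+1) :=
  [set f | exists f' g, @ideal_J0 C n.+1 a f' /\ f = f' + z * g].
have [J0 JD JM] := @J0_is_ideal C n a.
have Dlike : is_ideal D.
  split; first by exists 0, 0; rewrite mulr0 addr0.
    move=> x y [x' [g [x'J ->]]] [y' [h [y'J ->]]].
    by exists (x' + y'), (g + h); rewrite mulrDr addrACA; split=> //; apply: JD.
  move=> c x [x' [g [x'J ->]]]; exists (c * x'), (c * g).
  by rewrite mulrDr [c * (z * g)]mulrCA; split=> //; apply: JM.
suff JD' : @ideal_J0 C n.+1 a.+1 `<=` D by apply: JD'.
apply: ideal_gen_sub => // x [i [j [[iE] ja ->]]].
have -> : i = ord_max by apply: val_inj.
have [jlt|aj|ja'] := ltngtP j a; last 1 first.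
- exists 0, 1; rewrite mulr1 add0r; split=> //.
  by congr (generic_mx _ _ _ _); apply: val_inj.
- exists (generic_mx C n.+1 ord_max j), 0; rewrite mulr0 addr0; split=> //.
  exact: J0_var.
- by move: ja; rewrite ltnS leqNgt aj.
Qed.

Lemma var_notin_JK (a : 'I_n.+1) k : (a < k)%N ->
  ~ JK_ideal a k (generic_mx C n.+1 ord_max a).
Proof.
move=> ak /JK_sub_vanishing /(_ (delta_mx ord_max a)) E.
suff : degeneracy_locus a n k (delta_mx ord_max a : 'M[C]_n.+1).
  by move=> /E/eqP; rewrite eval_generic mxE !eqxx oner_eq0.
split=> [j ja|].
  by rewrite mxE -[j == a]val_eqE /= ltn_eqF ?andbF.
exists (fun=> 0) => i _; rewrite mxE inord_val -[k == a]val_eqE /= gtn_eqF // andbF.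
by rewrite big1 // => j _; rewrite mul0r.
Qed.

(** Write [f = f' + z * g] with [z] the last generator of [J0].  Then [z * g] lies
    in the prime ideal [J0_(a-1) + K], which does not contain [z]; so [g] lies
    in it, which moves [f] into [J0_(a-1)] up to an element of [z * K]. *)
Lemma J0_cap_K (I : set (coord_ring C n.+1)) (a : nat) k : is_ideal I -> (a <= k)%N ->
  (forall j (B : 'I_k.+1 -> 'I_n.+1), (j < a)%N -> increasing B ->
     (forall c, (0 < B c)%N) -> I (generic_mx C n.+1 ord_max j * minor_poly C B)) ->
  @ideal_J0 C n.+1 a `&` ideal_K k `<=` I.
Proof.
move=> Ilike; have [I0 ID IM] := Ilike.
elim: a => [|a IH] ak IJK f [Jf Kf]; first by move: Jf; rewrite J0_0 => ->.
have an : (a < n.+1)%N by apply: ltn_trans ak _.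
have {}IH := IH (ltnW ak) (fun j B ja => IJK j B (leqW ja)).
have [f' [g [Jf' fE]]] := @J0_split (Ordinal an) f Jf.
set z := generic_mx _ _ _ _ in fE.
have [K0 KD KM] := @K_is_ideal C n k; have [J0 JD JM] := @J0_is_ideal C n a.
have : JK_ideal a k (z * g).
  exists (- f'); first by apply: is_ideal_opp => //; exact: J0_is_ideal.
  by exists f => //; rewrite fE addKr.
case/JK_mul; first by rewrite ak.
  by move=> /(@var_notin_JK (Ordinal an) k ak).
move=> [u Ju [v Kv gE]].
have zv : I (z * v).
  suff KI : ideal_K k `<=` [set v | I (z * v)] by apply: KI.
  apply: ideal_gen_sub; last by move=> x [B [Bi B0 ->]]; apply: IJK.
  split=> /= [|x y|c x]; rewrite ?mulr0 ?mulrDr //; first exact: ID.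
  by move=> Ix; rewrite mulrCA; apply: IM.
have -> : f = (f' + z * u) + z * v by rewrite fE gE mulrDr addrA.
apply: ID => //; apply: IH; split.
  by apply: JD => //; apply: JM.
have -> : f' + z * u = f - z * v by rewrite fE gE mulrDr addrA addrK.
by apply: is_ideal_sub; [exact: K_is_ideal| |apply: KM].
Qed.

Lemma JK0 k : JK_ideal 0 k = @ideal_K C n.+1 k.
Proof.
apply/seteqP; split; last by apply: ideal_add_subr; exact: J0_is_ideal.
apply: ideal_add_sub => //; first exact: K_is_ideal.
by rewrite J0_0 => f ->; case: (@K_is_ideal C n k).
Qed.

(** By [JK_ideal_vanishing] only a vanishing has to be checked; this replaces
    the Laplace expansion of the larger minors. *)
Lemma K_antitone k k' : (k <= k')%N -> @ideal_K C n.+1 k' `<=` @ideal_K C n.+1 k.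
Proof.
move=> kk; rewrite -[X in _ `<=` X]JK0 JK_ideal_vanishing ?orbT //.
apply: ideal_gen_sub; first exact: vanishing_is_ideal.
move=> f [B [Bi B0 ->]] M SM; rewrite [LHS]eval_minor.
exact: det_degenerate SM.
Qed.

End Primality.

(** * The ideal of the Hessenberg scheme *)

Section HessenbergFunctions.
Variables (n : nat) (h : 'I_n.+1 -> 'I_n.+1).
Hypotheses (n_gt0 : (0 < n)%N) (h_hess : hessenberg h) (h_indec : indecomposable h).

Lemma hess_mono (i j : 'I_n.+1) : (i <= j)%N -> (h i <= h j)%N.
Proof.
move: j => [j jn] /=; elim: j jn => [|j IH] jn.
  by rewrite leqn0 => /eqP i0; rewrite (_ : i = Ordinal jn) //; apply: val_inj.
rewrite leq_eqVlt => /orP[/eqP ij|ij].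
  by rewrite (_ : i = Ordinal jn) //; apply: val_inj.
apply: (leq_trans (IH (ltnW jn) ij)).
by case: h_hess => + _; apply.
Qed.

(** The last index is not a corner, as [h] already reaches its maximal value at
    the index before it. *)
Lemma corner_lt (i : 'I_n.+1) : corners h i -> (i < h i)%N.
Proof.
move=> ci; have [iN|] := ltnP i.+1 n.+1; first exact: h_indec.
rewrite ltnS leq_eqVlt ltnNge -ltnS ltn_ord orbF => /eqP iE.
have jn : (n.-1 < n.+1)%N by rewrite ltnS leq_pred.
have := ci (Ordinal jn); rewrite -iE prednK // => /(_ erefl) hlt.
have := @h_indec (Ordinal jn); rewrite /= prednK // => /(_ (ltnSn n)).
have := ltn_ord (h i); lia.
Qed.

Lemma corner_hess_lt (i j : 'I_n.+1) : corners h j -> (i < j)%N -> (h i < h j)%N.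
Proof.
move=> cj ij; have jn : (j.-1 < n.+1)%N by rewrite (leq_ltn_trans (leq_pred _)).
have jE : j.-1.+1 = j by rewrite prednK //; case: (val j) ij.
apply: leq_ltn_trans (cj (Ordinal jn) (esym jE)).
by apply: hess_mono; rewrite /= -ltnS jE.
Qed.

End HessenbergFunctions.

Lemma det_mxsub_mul (F : fieldType) (p r q k : nat) (A : 'M[F]_(p, r))
    (B : 'M[F]_(r, q)) (f : 'I_k -> 'I_p) (g : 'I_k -> 'I_q) :
  (r < k)%N -> \det (mxsub f g (A *m B)) = 0.
Proof.
move=> rk; rewrite mxsub_mul; set X := mxsub f id A; set Y := mxsub id g B.
apply/eqP; rewrite -[_ == _]negbK -unitfE; apply/negP => u.
have rkXY : (\rank (X *m Y) <= r)%N := leq_trans (mxrankM_maxl X Y) (rank_leq_col X).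
by move: rkXY; rewrite mxrank_unit // leqNgt rk.
Qed.

Lemma increasing_ge (k m : nat) (B : 'I_k -> 'I_m) : increasing B ->
  (forall c, (0 < B c)%N) -> forall c : 'I_k, (c < B c)%N.
Proof.
move=> Bi B0 [c ck]; elim: c ck => [|c IH] ck; first exact: B0.
exact: leq_ltn_trans (IH (ltnW ck)) (Bi (Ordinal (ltnW ck)) (Ordinal ck) (ltnSn c)).
Qed.

Section HessenbergIdeal.
Variables (C : numFieldType) (n : nat) (h : 'I_n.+1 -> 'I_n.+1).
Hypotheses (n_gt0 : (0 < n)%N) (h_hess : hessenberg h) (h_indec : indecomposable h).
Let N := nilp_mx C n.+1.
Let Q (i : 'I_n.+1) : set (coord_ring C n.+1) := JK_ideal i (h i).

Lemma nilp_mul (R : nzRingType) (phi : {rmorphism C -> R}) (Z : 'M[R]_n.+1) r c :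
  (map_mx phi N *m Z) r c = if r == 0 then Z ord_max c else 0.
Proof.
rewrite mxE (bigD1 ord_max) //= !mxE eqxx andbT big1 => [|l lN].
  by rewrite -val_eqE /=; case: eqP; rewrite rmorph_nat addr0 ?mul1r ?mul0r.
rewrite !mxE (_ : (l.+1 == n.+1) = false) ?andbF ?rmorph0 ?mul0r //.
by apply: contraNF lN => /eqP[lE]; apply/eqP/val_inj.
Qed.

Lemma hess_ideal_at_is_ideal i : is_ideal (hess_ideal_at N h i).
Proof.
rewrite /hess_ideal_at; case: ifP => _; first exact: ideal_gen_is_ideal.
by split=> [|x y -> ->|c x ->]; rewrite /= ?addr0 ?mulr0.
Qed.

Lemma hess_ideal_is_ideal : is_ideal (hess_ideal N h).
Proof. by apply: ideal_sum_is_ideal => i; apply: hess_ideal_at_is_ideal. Qed.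

(** The minor in the rows [0] and [B], the column [j] of the first block and all
    the columns of the second block: its first column has one non-zero entry. *)
Lemma hess_ideal_gen (i j : 'I_n.+1) (B : 'I_(h i).+1 -> 'I_n.+1) : (j <= i)%N ->
  increasing B -> (forall c, (0 < B c)%N) ->
  hess_ideal N h (generic_mx C n.+1 ord_max j * minor_poly C B).
Proof.
move=> ji Bi B0.
have hn : ((h i).+1 < n.+1)%N.
  rewrite ltnS (leq_trans (increasing_ge Bi B0 ord_max)) //.
  by rewrite -ltnS ltn_ord.
apply: (@ideal_sum_mem _ _ _ i).
  by move=> l; case: (hess_ideal_at_is_ideal l).
rewrite /hess_ideal_at hn; apply: ideal_gen_mem.
pose f (x : 'I_(h i).+2) := if unlift ord0 x is Some c then B c else ord0.
pose g (x : 'I_(h i).+2) := if unlift ord0 x is Some c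
  then rshift i.+1 c else lshift (h i).+1 (inord j).
exists f, g; split.
- move=> a b; rewrite /f; case: unliftP => [c ->|->]; case: unliftP => [d ->|->] //.
  by move=> cd; apply: Bi; rewrite !lift0 in cd.
- move=> a b; rewrite /g; case: unliftP => [c ->|->]; case: unliftP => [d ->|->] //.
    by rewrite !lift0 /= ltnS ltn_add2l.
  by move=> _ /=; rewrite (leq_trans (ltn_ord _)) // leq_addr.
rewrite (expand_det_col _ ord0) (bigD1 ord0) //= big1 ?addr0; last first.
  move=> x; case: (unliftP ord0 x) => [c -> _|->]; last by rewrite eqxx.
  rewrite mxE /f /g liftK unlift_none row_mxEl mxE nilp_mul.
  by rewrite -val_eqE /= eqn0Ngt B0 mul0r.
rewrite [X in _ = X * _]mxE /f /g unlift_none row_mxEl.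
rewrite [X in _ = X * _]mxE nilp_mul eqxx; congr (_ * _).
  by congr (generic_mx _ _ _ _); apply: val_inj; rewrite /= inordK.
rewrite /cofactor addn0 expr0 mul1r; congr (\det _); apply/matrixP => x y.
by rewrite [LHS]mxE 3![in RHS]mxE !liftK row_mxEr [RHS]mxE.
Qed.

(** At a point of the locus the matrix has rank at most [h i + 1] (1-based:
    [h(i)]).  If [i < l] its first block is zero.  Otherwise its columns are
    spanned by those of the second block, in which the dependent column [h l]
    is replaced by the first basis vector. *)
Lemma hess_rank_factor (i l : 'I_n.+1) M :
  corners h l -> degeneracy_locus l n (h l) M ->
  exists (E : 'M[C]_(n.+1, (h i).+1)) (X : 'M[C]_((h i).+1, i.+1 + (h i).+1)),
    row_mx (colsub (widen_ord (ltn_ord i)) (N *m M))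
           (colsub (widen_ord (ltn_ord (h i))) M) = E *m X.
Proof.
have NM r c : (N *m M) r c = if r == 0 then M ord_max c else 0.
  rewrite -(nilp_mul idfun); congr ((_ *m M) r c).
  by apply/matrixP => i' j'; rewrite !mxE.
move=> cl [Ml0 [nu Mnu]]; have [il|li] := ltnP i l.
  exists (colsub (widen_ord (ltn_ord (h i))) M), (row_mx 0 1%:M).
  rewrite mul_mx_row mulmx0 mulmx1; congr row_mx; apply/matrixP => r c.
  rewrite [LHS]mxE NM [RHS]mxE; case: ifP => // _.
  have <- : inord n = ord_max :> 'I_n.+1 by apply: val_inj; rewrite /= inordK.
  by apply: Ml0; apply: leq_trans il; rewrite ltnS /= -ltnS ltn_ord.
have hl : (h l <= h i)%N by apply: hess_mono.
pose b : 'I_(h i).+1 := inord (h l).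
have bE : b = h l :> nat by rewrite inordK.
have bW : widen_ord (ltn_ord (h i)) b = h l by apply: val_inj.
pose w := widen_ord (ltn_ord (h i)).
(* The columns of [E] span; [S r] is what the relation predicts in column [h l],
   and it can be wrong only in row 0. *)
pose E : 'M[C]_(n.+1, (h i).+1) := \matrix_(r, c)
  if c == b then (r == 0)%:R else M r (w c).
pose S r := \sum_(c < (h i).+1 | (c < b)%N) nu (w c) * M r (w c).
have S_col (r : 'I_n.+1) : (0 < r)%N -> M r (h l) = S r.
  move=> r0; have := Mnu r; rewrite r0 -ltnS ltn_ord inord_val => -> //.
  rewrite /S bE (big_ord_narrow (ltnW (ltn_ord (h l)))).
  rewrite (big_ord_narrow (leqW hl)).
  by apply: eq_bigr => c _; congr (nu _ * M _ _); apply: val_inj.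
exists E.
exists (row_mx
  (\matrix_(c, d) if c == b then M ord_max (widen_ord (ltn_ord i) d) else 0)
  (\matrix_(c, d) if d == b then
      (if c == b then M 0 (h l) - S 0 else if (c < b)%N then nu (w c) else 0)
    else (c == d)%:R)).
rewrite mul_mx_row; congr row_mx; apply/matrixP => r d; rewrite [LHS]mxE [RHS]mxE.
  rewrite NM (bigD1 b) //= !mxE !eqxx big1 ?addr0 => [|c cb]; last first.
    by rewrite !mxE (negbTE cb) mulr0.
  by case: eqP; rewrite ?mul1r ?mul0r.
have [->|db] := eqVneq d b; last first.
  rewrite (bigD1 d) //= !mxE (negbTE db) eqxx mulr1 big1 ?addr0 // => c cd.
  by rewrite !mxE (negbTE db) (negbTE cd) mulr0.
rewrite bW (bigD1 b) //= !mxE !eqxx.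
rewrite (eq_bigr (fun c : 'I_(h i).+1 =>
    if (c < b)%N then nu (w c) * M r (w c) else 0)).
  rewrite -big_mkcondr.
  rewrite (eq_bigl (fun c : 'I_(h i).+1 => (c < b)%N)) -/(S r); last first.
    by move=> c /=; rewrite andb_idl // => cb; rewrite -val_eqE neq_ltn cb.
  have [->|r0] := eqVneq r 0; first by rewrite mul1r subrK.
  by rewrite mul0r add0r S_col // lt0n.
move=> c cb; rewrite !mxE eqxx (negbTE cb); case: ifP => _; last by rewrite mulr0.
by rewrite mulrC.
Qed.

Lemma hess_ideal_sub_JK l : corners h l -> hess_ideal N h `<=` Q l.
Proof.
move=> cl; apply: ideal_sum_sub; first exact: JK_is_ideal.
move=> i; rewrite /hess_ideal_at; case: ifP => _; last first.
  by move=> _ ->; case: (@JK_is_ideal C n l (h l)).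
have hl := corner_lt n_gt0 h_indec cl.
rewrite /Q JK_ideal_vanishing ?hl //.
apply: ideal_gen_sub; first exact: vanishing_is_ideal.
move=> p [f [g [_ _ ->]]] M SM.
have [E [X EX]] := hess_rank_factor i cl SM.
have := @det_mxsub_mul _ _ _ _ _ E X f g (ltnSn _); rewrite -EX => <-.
rewrite /eval_mx -det_map_mx; congr (\det _).
rewrite map_mxsub; congr (mxsub f g _).
rewrite map_row_mx; congr row_mx; apply/matrixP => r c; rewrite !mxE.
  rewrite rmorph_sum; apply: eq_bigr => j _.
  by rewrite rmorphM !mxE /= mevalC mevalXU mxvecE.
by rewrite /= mevalXU mxvecE.
Qed.

(** For the inclusion from right to left: an [f] in all the components is, for each
    [i], the sum of an element of the Hessenberg ideal and of one of [K_(h i)].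
    The step from [i] to [i + 1] uses the component of a corner and
    [J0_cap_K]; for the last [i] the ideal [K_(h i)] is zero. *)
Theorem hess_ideal_cap : hess_ideal N h = \bigcap_(i in corners h) Q i.
Proof.
apply/seteqP; split=> [f If l cl|f fQ]; first exact: hess_ideal_sub_JK If.
have [I0 ID IM] := hess_ideal_is_ideal.
suff step (i : nat) (ip : (i < n.+1)%N) :
    ideal_add (hess_ideal N h) (ideal_K (h (Ordinal ip))) f.
  have [a Ia [b Kb ->]] := step n (ltnSn n); apply: ID => //.
  suff : ideal_K (h (Ordinal (ltnSn n))) `<=` hess_ideal N h by apply.
  apply: ideal_gen_sub => [|p [B [Bi B0 _]]]; first exact: hess_ideal_is_ideal.
  have := increasing_ge Bi B0 ord_max; rewrite ltnNge -ltnS.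
  move/negP; case; apply: leq_trans (ltn_ord _) _.
  by case: h_hess => _ /(_ (Ordinal (ltnSn n))).
elim: i ip => [|i IH] ip.
  have := fQ (Ordinal ip); rewrite /Q JK0 => /(_ _) Kf.
  apply: ideal_add_subr; first exact: hess_ideal_is_ideal.
  by apply: Kf => j.
have [s Is [u Ku fE]] := IH (ltnW ip).
set j := Ordinal (ltnW ip) in Ku; set j' := Ordinal ip.
have hjj : (h j <= h j')%N by case: h_hess => + _; apply.
have := hjj; rewrite leq_eqVlt => /orP[/eqP hE|hlt].
  by exists s => //; exists u => //; rewrite (_ : h j' = h j) //; apply: val_inj.
have cj' : corners h j'.
  by move=> l [lE]; rewrite (_ : l = j) //; apply: val_inj.
have [t Jt [v Kv uE]] : Q j' u.
  rewrite (_ : u = f - s); last by rewrite fE addrC addKr.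
  by apply: is_ideal_sub; [exact: JK_is_ideal | exact: fQ | exact: hess_ideal_sub_JK Is].
exists (s + t); last by exists v; rewrite // fE uE addrA.
apply: ID => //; apply: (@J0_cap_K C n (hess_ideal N h) i.+1 (h j) hess_ideal_is_ideal).
- by exact: (@h_indec j ip).
- by move=> l B li Bi B0; apply: hess_ideal_gen.
split=> //; rewrite (_ : t = u - v); last by rewrite uE addrK.
apply: is_ideal_sub => //; first exact: K_is_ideal.
exact: K_antitone Kv.
Qed.

End HessenbergIdeal.

(** * Shortest permutations and inversions *)

Section Inversions.
Variable n : nat.
Implicit Types (s t w : 'S_n.+1) (i k x y : 'I_n.+1).

Definition inversions s : {set 'I_n.+1 * 'I_n.+1} :=
  [set p : 'I_n.+1 * 'I_n.+1 | (p.1 < p.2)%N && (s p.2 < s p.1)%N]%SET.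

(** A permutation is recovered from the comparisons of its values, that is, from
    its inversions: see [inversions_inj]. *)
Lemma perm_rank s x : #|[set y | (s y < s x)%N]%SET| = s x.
Proof.
transitivity #|[set v : 'I_n.+1 | (v < s x)%N]%SET|.
  rewrite -[RHS](card_preimset _ (@perm_inj _ s)); apply: eq_card => y.
  by rewrite !inE.
rewrite -sum1_card; under eq_bigl do rewrite inE.
by rewrite (big_ord_narrow (ltnW (ltn_ord (s x)))) sum1_card card_ord.
Qed.

Lemma inversions_inj : injective inversions.
Proof.
move=> s t st; apply/permP => x; apply: val_inj.
rewrite /= -(perm_rank s x) -(perm_rank t x).
apply: eq_card => y; rewrite !inE.
have inv2 (a b : 'I_n.+1) : (a < b)%N && (s b < s a)%N = (a < b)%N && (t b < t a)%N.
  by have /setP/(_ (a, b)) := st; rewrite !inE.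
have perm_lt (u : 'S_n.+1) : (u y < u x)%N =
    (y < x)%N && ~~ ((y < x)%N && (u x < u y)%N) || (x < y)%N && (u y < u x)%N.
  case: (ltngtP y x) => [||/val_inj->]; rewrite ?ltnn //= orbF.
  move=> yx; rewrite -leqNgt [RHS]leq_eqVlt; case: eqP => // /val_inj/perm_inj E.
  by rewrite E ltnn in yx.
by rewrite perm_lt [RHS]perm_lt !inv2.
Qed.

Lemma shortest_inversions (P : pred 'S_n.+1) w : P w ->
  (forall s, P s -> inversions w \subset inversions s) -> is_shortest P w.
Proof.
move=> Pw wmin; rewrite /is_shortest Pw; apply/forallP => s; apply/implyP.
case/andP => Ps sw; apply: proper_card; rewrite finset.properEneq wmin // andbT.
by apply: contraNneq sw => /inversions_inj->.
Qed.

Lemma shortestE (P : pred 'S_n.+1) w : is_shortest P w -> shortest P = w.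
Proof.
move=> sw; rewrite /shortest; case: pickP => [s ss|/(_ w)]; last by rewrite sw.
apply/eqP/negPn/negP => /= sNw; case/andP: ss => Ps /forallP/(_ w).
case/andP: sw => Pw /forallP/(_ s); rewrite Ps sNw /= Pw eq_sym sNw /= => ws sw.
by have := ltn_trans ws sw; rewrite ltnn.
Qed.

Lemma lift_perm0E k x :
  lift_perm k ord0 1%g x = (if x == k then 0 else if x < k then x.+1 else x)%N :> nat.
Proof.
case: (unliftP k x) => [j ->|->]; last by rewrite lift_perm_id eqxx.
rewrite lift_perm_lift perm1 eq_sym (negbTE (neq_lift _ _)) /= /bump leq0n add1n.
by case: (leqP k j) => kj; rewrite /= in kj *; rewrite ?add1n ?add0n;
   do ?[case: ifP => ?]; lia.
Qed.

Lemma lift_perm_maxE k x :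
  lift_perm k ord_max 1%g x =
  (if x == k then n else if x < k then x : nat else x.-1)%N :> nat.
Proof.
case: (unliftP k x) => [j ->|->]; last by rewrite lift_perm_id eqxx.
rewrite lift_perm_lift perm1 eq_sym (negbTE (neq_lift _ _)) lift_max /= /bump.
by case: (leqP k j) => kj; rewrite /= in kj *; rewrite ?add1n ?add0n;
   do ?[case: ifP => ?]; lia.
Qed.

Lemma forced_inversion0 s i y : s i = 0%N :> nat -> (y < i)%N -> (s i < s y)%N.
Proof.
move=> si yi; rewrite si lt0n; apply: contraTneq yi => sy.
have /perm_inj-> : s y = s i by apply: val_inj; rewrite /= sy si.
by rewrite ltnn.
Qed.

Lemma forced_inversion_max s k y : s k = n :> nat -> (k < y)%N -> (s y < s k)%N.
Proof.
move=> sk ky; rewrite ltn_neqAle sk -ltnS ltn_ord andbT.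
apply: contraTneq ky => sy.
have /perm_inj-> : s y = s k by apply: val_inj; rewrite /= sy sk.
by rewrite ltnn.
Qed.

Lemma perm_uE k : perm_u k = lift_perm k ord0 1%g.
Proof.
apply: shortestE; apply: shortest_inversions => [|s /eqP sk].
  by rewrite lift_perm0E eqxx.
apply/fintype.subsetP => -[x y]; rewrite !inE /= !lift_perm0E -!val_eqE /= => inv.
have yk : y = k by apply: val_inj => /=; move: inv; do ?[case: ifP => ?]; lia.
by rewrite yk in inv *; rewrite forced_inversion0 ?andbT //; case/andP: inv.
Qed.

Lemma perm_vE k : perm_v k = lift_perm k ord_max 1%g.
Proof.
apply: shortestE; apply: shortest_inversions => [|s /eqP[sk]].
  by rewrite lift_perm_maxE eqxx.
apply/fintype.subsetP => -[x y]; rewrite !inE /= !lift_perm_maxE -!val_eqE /= => inv.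
have xk : x = k.
  by apply: val_inj => /=; move: inv (ltn_ord y); do ?[case: ifP => ?]; lia.
by rewrite xk in inv *; rewrite forced_inversion_max ?andbT //; case/andP: inv.
Qed.

Lemma perm_wE i k x : (i < k)%N ->
  perm_w i k x = (if x == i then 0 else if x == k then n else
    if x < i then x.+1 else if x < k then x : nat else x.-1)%N :> nat.
Proof.
move=> ik; rewrite /perm_w /perm_comp permM perm_uE perm_vE.
have := lift_perm_maxE k x; move: (lift_perm k ord_max 1%g x) => y.
rewrite lift_perm0E -!val_eqE /=; have := ltn_ord k; have := ltn_ord x.
by do ?[case: ifP => ?]; lia.
Qed.

(** [perm_w i k] has no other inversions than those forced by its values at [i]
    and [k]. *)
Lemma perm_w_inversion i k x y : (i < k)%N ->
  (x < y)%N -> (perm_w i k y < perm_w i k x)%N -> y = i \/ x = k.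
Proof.
move=> ik xy; rewrite !perm_wE // -!val_eqE /= => inv.
suff [E|E] : y = i :> nat \/ x = k :> nat.
- by left; apply: val_inj.
- by right; apply: val_inj.
have := ltn_ord y; have := ltn_ord x; move: inv.
by do ?[case: ifP => ?]; lia.
Qed.

Lemma perm_w_shortest i k : (i < k)%N ->
  is_shortest (fun s : 'S_n.+1 => (s i == 0%N :> nat) && ((s k).+1 == n.+1))
    (perm_w i k).
Proof.
move=> ik; apply: shortest_inversions => [|s /andP[/eqP si /eqP[sk]]].
  rewrite !perm_wE // !eqxx /=.
  by have [ki|_] := eqVneq k i; [rewrite ki ltnn in ik | rewrite eqxx].
apply/fintype.subsetP => -[x y]; rewrite !inE /= => /andP[xy inv]; rewrite xy.
have [E|E] := perm_w_inversion ik xy inv; subst.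
  exact: forced_inversion0.
exact: forced_inversion_max.
Qed.

Lemma w0_perm_wE i k x : (perm_comp (perm_w0 n.+1) (perm_w i k) x =
  n - perm_w i k x :> nat)%N.
Proof. by rewrite /perm_comp permM permE /= subSS. Qed.

End Inversions.

(** * Density of the Bruhat cell *)

Section Triangular.
Variable C : fieldType.

(** Gaussian elimination with the top left entry [d] as pivot, which is not zero
    at [t = 1].  The Schur complement is multiplied by [d] to keep polynomial
    entries; it is again the identity at [t = 1]. *)
Lemma lu_specialization m (A : 'M[{poly C}]_m) :
  map_mx (horner_eval 1) A = 1%:M ->
  exists2 q : {poly C}, q.[1] != 0 & forall t, q.[t] != 0 ->
    exists U V : 'M[C]_m, [/\ U *m V = 1%:M, is_trig_mx U, is_trig_mx V
      & is_trig_mx (V *m map_mx (horner_eval t) A)^T].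
Proof.
elim: m A => [|m IH] A A1.
  exists 1; first by rewrite hornerE oner_neq0.
  move=> t _; exists 1%:M, 1%:M; rewrite mulmx1 mul1mx.
  by split=> //; apply/is_trig_mxP => -[].
move: A A1; rewrite -[m.+1]/(1 + m)%N => A A1.
set d := ulsubmx A 0 0.
pose S := d *: drsubmx A - dlsubmx A *m ursubmx A.
have dA t : map_mx (horner_eval t) (ulsubmx A) = (d.[t])%:M.
  by apply/matrixP => x y; rewrite !ord1 mxE [RHS]mxE eqxx.
have St t : map_mx (horner_eval t) S = d.[t] *: map_mx (horner_eval t) (drsubmx A)
    - map_mx (horner_eval t) (dlsubmx A) *m map_mx (horner_eval t) (ursubmx A).
  by rewrite map_mxB map_mxZ map_mxM.
have [d1 ur1 dl1 dr1] : [/\ d.[1] = 1, map_mx (horner_eval 1) (ursubmx A) = 0,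
    map_mx (horner_eval 1) (dlsubmx A) = 0 & map_mx (horner_eval 1) (drsubmx A) = 1%:M].
  move: A1; rewrite -{1}[A]submxK map_block_mx dA scalar_mx_block.
  by case/eq_block_mx => /matrixP/(_ 0 0); rewrite !mxE.
have [|q q1 IHq] := IH S; first by rewrite St d1 dr1 dl1 mul0mx subr0 scale1r.
exists (d * q); first by rewrite hornerM d1 mul1r.
move=> t; rewrite hornerM mulf_eq0 negb_or => /andP[dt qt].
have [U [V [UV Ut Vt Rt]]] := IHq t qt.
move: {dA St}(dA t) (St t) => dA St.
set e := d.[t] in dt dA St *; set L := map_mx _ (dlsubmx A) in St.
exists (block_mx 1%:M 0 (e^-1 *: L) U), (block_mx 1%:M 0 (- e^-1 *: (V *m L)) V).
split.
- rewrite mulmx_block !mulmx1 !mul1mx !mulmx0 !mul0mx !addr0 !add0r UV.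
  by rewrite -scalemxAr mulmxA UV mul1mx scaleNr subrr -scalar_mx_block.
- by rewrite is_trig_block_mx // eqxx Ut scalar_mx_is_trig.
- by rewrite is_trig_block_mx // eqxx Vt scalar_mx_is_trig.
rewrite -{1}[A]submxK map_block_mx dA -/L mulmx_block !mul1mx !mul0mx !addr0.
have -> : - e^-1 *: (V *m L) *m e%:M + V *m L = 0.
  by rewrite mul_mx_scalar scalerA mulrN mulfV // scaleN1r addNr.
rewrite tr_block_mx is_trig_block_mx // trmx0 eqxx tr_scalar_mx scalar_mx_is_trig /=.
rewrite -scalemxAl -mulmxA scaleNr addrC scalemxAr -mulmxBr.
suff -> : map_mx (horner_eval t) (drsubmx A) -
    e^-1 *: (L *m map_mx (horner_eval t) (ursubmx A)) =
    e^-1 *: map_mx (horner_eval t) S.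
  rewrite -scalemxAr linearZ /=; apply/is_trig_mxP => x y xy.
  by rewrite mxE (is_trig_mxP Rt) // mulr0.
by rewrite St scalerBr scalerA mulVf // scale1r.
Qed.

Local Notation rev_mx := (mxsub (@rev_ord _) (@rev_ord _)).

Lemma rev_mxM (R : pzSemiRingType) m (A B : 'M[R]_m) :
  rev_mx (A *m B) =
  rev_mx A *m rev_mx B.
Proof.
apply/matrixP => x y; rewrite !mxE [LHS](reindex_inj (@rev_ord_inj m)).
by apply: eq_bigr => z _; rewrite !mxE.
Qed.

Lemma rev_mxK (R : Type) m : involutive (fun A : 'M[R]_m => rev_mx A).
Proof. by move=> A; apply/matrixP => x y; rewrite !mxE !rev_ordK. Qed.

Lemma rev_mx1 (R : pzSemiRingType) m : rev_mx 1%:M = 1%:M :> 'M[R]_m.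
Proof. by apply/matrixP => x y; rewrite !mxE (inj_eq rev_ord_inj). Qed.

(** Reversing rows and columns exchanges the two kinds of triangular matrices. *)
Lemma rev_mx_trig m (A : 'M[C]_m) :
  is_trig_mx A -> is_trig_mx (rev_mx A)^T.
Proof.
move=> /is_trig_mxP At; apply/is_trig_mxP => x y xy; rewrite !mxE At //=.
by have := ltn_ord y; lia.
Qed.

Lemma ul_specialization m (A : 'M[{poly C}]_m) :
  map_mx (horner_eval 1) A = 1%:M ->
  exists2 q : {poly C}, q.[1] != 0 & forall t, q.[t] != 0 ->
    exists U V : 'M[C]_m, [/\ U *m V = 1%:M, is_trig_mx U^T, is_trig_mx V^T
      & is_trig_mx (V *m map_mx (horner_eval t) A)].
Proof.
move=> A1.
have [|q q1 qP] := @lu_specialization m (rev_mx A).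
  by rewrite map_mxsub A1 rev_mx1.
exists q => // t /qP[U [V [UV Ut Vt Rt]]].
exists (rev_mx U), (rev_mx V); split; rewrite ?rev_mx_trig //.
  by rewrite -rev_mxM UV rev_mx1.
have := rev_mx_trig Rt; rewrite -[_^T]/(trmx _) /= => Lt.
suff <- : (rev_mx (V *m map_mx (horner_eval t) (rev_mx A))^T)^T =
   rev_mx V *m map_mx (horner_eval t) A by [].
rewrite [LHS](_ : _ = rev_mx (V *m map_mx (horner_eval t) (rev_mx A))); last first.
  by apply/matrixP => x y; rewrite [LHS]mxE [LHS]mxE [LHS]mxE [RHS]mxE.
by rewrite rev_mxM; congr (_ *m _); rewrite map_mxsub; exact: rev_mxK.
Qed.

End Triangular.

Section BruhatCell.
Variables (C : numFieldType) (n : nat) (i k : 'I_n.+1).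
Hypothesis ik : (i < k)%N.
Let W := perm_comp (perm_w0 n.+1) (perm_w i k).
Implicit Types (M : 'M[C]_n.+1) (x y r c : 'I_n.+1).

Definition bruhat_cell (w : 'S_n.+1) : set 'M[C]_n.+1 :=
  [set M | exists2 b, upper_triangular_unit b &
    exists2 b', upper_triangular_unit b' & M = b *m perm_dot C w *m b'].

Let Wi : W i = ord_max.
Proof. by apply: val_inj; rewrite /= w0_perm_wE perm_wE // eqxx subn0. Qed.

Let Wk : W k = ord0.
Proof.
apply: val_inj; rewrite /= w0_perm_wE perm_wE // -!val_eqE /= eqxx.
by rewrite gtn_eqF // subnn.
Qed.

(** The inversions of [perm_w] are the non-inversions of [W]. *)
Let W_lt x y : (y < x)%N -> x != i -> y != k -> (W x < W y)%N.
Proof.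
move=> yx xi yk; rewrite !w0_perm_wE ltn_sub2l //; first last.
  rewrite ltnNge; apply/negP; rewrite leq_eqVlt => /orP[/eqP/val_inj/perm_inj E|].
    by rewrite E ltnn in yx.
  by case/(perm_w_inversion ik yx) => /eqP; rewrite ?(negbTE xi) ?(negbTE yk).
have := ltn_ord (perm_w i k y); rewrite ltnS leq_eqVlt => /orP[/eqP E|//].
have : perm_w i k y = perm_w i k k.
  apply: val_inj; rewrite /= E perm_wE // -!val_eqE /= eqxx gtn_eqF //.
by move/perm_inj/eqP; rewrite (negbTE yk).
Qed.

Lemma perm_dotE (w : 'S_n.+1) r c : perm_dot C w r c = (w c == r)%:R.
Proof. by rewrite !mxE. Qed.

Lemma upperP (b : 'M[C]_n.+1) :
  upper_triangular_unit b -> forall r c, (c < r)%N -> b r c = 0.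
Proof. by move=> [_ /is_trig_mxP bt] r c cr; rewrite -(bt c r cr) mxE. Qed.

Lemma cell_entry (w : 'S_n.+1) (b b' : 'M[C]_n.+1) r c :
  (b *m perm_dot C w *m b') r c = \sum_y b r (w y) * b' y c.
Proof.
rewrite mxE; apply: eq_bigr => y _; rewrite mxE (bigD1 (w y)) //=.
rewrite perm_dotE eqxx mulr1 big1 ?addr0 // => z zw.
by rewrite perm_dotE eq_sym (negbTE zw) mulr0.
Qed.

(** An entry of [b w b'] in the last row is the one of row [i] of [b'], up to a
    factor.  The submatrices cut out by the [p_B] factor through the columns of
    the permutation matrix up to [k], of which the last only has an entry in
    row 0, where [B] has no row. *)
Lemma cell_sub_locus :
  bruhat_cell W `<=` [set M | forall f, JK_ideal i k f -> eval_mx M f = 0].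
Proof.
move=> M [b ub [b' ub' ->]] f.
suff : JK_ideal i k `<=` vanishing_ideal [set b *m perm_dot C W *m b'].
  by move=> H /H; apply.
apply: ideal_add_sub; first exact: vanishing_is_ideal.
  apply: ideal_gen_sub => [|p [i' [j [iE ji ->]]] _ ->]; first exact: vanishing_is_ideal.
  have -> : i' = ord_max by apply: val_inj; case: iE.
  rewrite eval_generic cell_entry big1 // => y _.
  have [->|yi] := eqVneq y i; first by rewrite (upperP ub') ?mulr0.
  rewrite (upperP ub) ?mul0r //= ltn_neqAle -ltnS ltn_ord andbT.
  by apply: contraNneq yi => Wy; apply/eqP/(@perm_inj _ W); rewrite Wi; apply: val_inj.
apply: ideal_gen_sub => [|p [B [Bi B0 ->]] _ ->]; first exact: vanishing_is_ideal.
rewrite [LHS]eval_minor.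
pose w := widen_ord (ltn_ord k).
have -> : mxsub B w (b *m perm_dot C W *m b') =
    (\matrix_(x, y) b (B x) (W (w y))) *m (\matrix_(x, y) b' (w x) (w y)).
  apply/matrixP => x y; rewrite mxE cell_entry [RHS]mxE.
  rewrite (bigID (fun z : 'I_n.+1 => (z < k.+1)%N)) /= [X in _ + X]big1 ?addr0.
    by rewrite (big_ord_narrow (ltn_ord k)); apply: eq_bigr => z _; rewrite !mxE.
  move=> z; rewrite -leqNgt => kz; rewrite (upperP ub') ?mulr0 //=.
  exact: leq_trans (ltn_ord y) kz.
rewrite det_mulmx (expand_det_col _ ord_max) big1 ?mul0r // => x _.
rewrite mxE (_ : w ord_max = k); last exact: val_inj.
by rewrite Wk (upperP ub) ?mul0r.
Qed.

Lemma dot_in_locus : degeneracy_locus i n k (perm_dot C W).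
Proof.
split=> [j ji|].
  rewrite perm_dotE (_ : inord n = W i); last first.
    by rewrite Wi; apply: val_inj; rewrite /= inordK.
  by rewrite (inj_eq (@perm_inj _ W)) -val_eqE /= ltn_eqF.
exists (fun=> 0) => r /andP[r0 _]; rewrite inord_val perm_dotE Wk.
rewrite -val_eqE /= ltn_eqF //.
by rewrite big1 // => j _; rewrite mul0r.
Qed.

Lemma dot_trK : perm_dot C W *m (perm_dot C W)^T = 1%:M.
Proof.
rewrite /perm_dot trmxK tr_perm_mx.
by rewrite -perm_mxM mulVg perm_mx1.
Qed.

(** With [M w^-1 = U L], the matrix [b' = w^-1 L w] has the entry
    [L (W x) (W y)] at [(x, y)].  Below the diagonal this is above the diagonal
    of [L], except if [x = i] or [y = k].  In the first case it is, up to a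
    factor, the entry of [M] in the last row and column [y < i].  In the second
    case the relation between the columns of [M] expresses it by entries above
    the diagonal of [L]. *)
Lemma generic_in_cell M (U V : 'M[C]_n.+1) : degeneracy_locus i n k M -> M \in unitmx ->
  U *m V = 1%:M -> is_trig_mx U^T -> is_trig_mx V^T ->
  is_trig_mx (V *m (M *m (perm_dot C W)^T)) -> bruhat_cell W M.
Proof.
move=> [M0 [l Ml]] uM UV Ut Vt /is_trig_mxP Lt.
have [uU uV] := mulmx1_unit UV.
have Vup : forall r c, (c < r)%N -> V r c = 0 by apply: upperP; split.
have dotV : (perm_dot C W)^T *m perm_dot C W = 1%:M by apply/mulmx1C/dot_trK.
have [uD uDt] := mulmx1_unit dot_trK.
set D := perm_dot C W in dotV uD uDt Lt *; set L := V *m (M *m D^T) in Lt.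
have AE r y : (M *m D^T) r (W y) = M r y.
  rewrite mxE (bigD1 y) //= mxE perm_dotE eqxx mulr1 big1 ?addr0 // => z zy.
  by rewrite mxE perm_dotE (inj_eq (@perm_inj _ W)) (negbTE zy) mulr0.
exists U => //; exists (D^T *m L *m D); last first.
  by rewrite !mulmxA -(mulmxA U D) dot_trK mulmx1 UV mul1mx -mulmxA dotV mulmx1.
split; first by rewrite !unitmx_mul uDt uD uV uM.
apply/is_trig_mxP => y x yx; rewrite mxE.
have -> : (D^T *m L *m D) x y = L (W x) (W y).
  rewrite mxE (bigD1 (W y)) //= perm_dotE eqxx mulr1 big1 ?addr0; last first.
    by move=> z zW; rewrite perm_dotE eq_sym (negbTE zW) mulr0.
  rewrite mxE (bigD1 (W x)) //= mxE perm_dotE eqxx mul1r big1 ?addr0 // => z zW.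
  by rewrite mxE perm_dotE eq_sym (negbTE zW) mul0r.
have LE r z : L r (W z) = \sum_s V r s * M s z.
  by rewrite mxE; apply: eq_bigr => s _; rewrite AE.
have [xi|xi] := eqVneq x i.
  rewrite xi Wi LE big1 // => s _.
  have [->|sn] := eqVneq s ord_max.
    rewrite (_ : ord_max = inord n); last by apply: val_inj; rewrite /= inordK.
    by rewrite M0 ?mulr0 // -xi.
  rewrite Vup ?mul0r //= ltn_neqAle -ltnS ltn_ord andbT.
  by apply: contraNneq sn => sE; apply/eqP/val_inj.
have [yk|yk] := eqVneq y k; last by apply: Lt; apply: W_lt.
rewrite yk in yx *.
have Wx0 : (0 < W x)%N.
  rewrite lt0n; apply: contraTneq yx => Wx.
  have /perm_inj-> : W x = W k by rewrite Wk; apply: val_inj.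
  by rewrite ltnn.
have -> : L (W x) (W k) = \sum_(j < n.+1 | (j < k)%N) l j * L (W x) (W j).
  rewrite LE; under [RHS]eq_bigr => j _ do rewrite LE mulr_sumr.
  rewrite exchange_big /=; apply: eq_bigr => s _.
  have [s0|s0] := posnP s.
    by rewrite Vup ?s0 // mul0r big1 // => j _; rewrite mul0r mulr0.
  have := Ml s; rewrite s0 -ltnS ltn_ord inord_val => -> //.
  by rewrite mulr_sumr; apply: eq_bigr => j _; rewrite mulrCA.
rewrite big1 // => j jk; rewrite Lt ?mulr0 //; apply: W_lt => //.
  exact: ltn_trans jk yx.
by rewrite -val_eqE /= ltn_eqF.
Qed.

(** Density of the cell in the locus: the general points of a curve from any
    point to the permutation matrix lie in the cell. *)
Theorem cell_vanishing : vanishing_ideal (bruhat_cell W) = @JK_ideal C n i k.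
Proof.
apply/seteqP; split=> f; last by move=> Qf M /cell_sub_locus; apply.
move=> f0; rewrite JK_ideal_vanishing ?ik // => M SM.
have ik' : (i < k)%N || (i == 0%N :> nat) by rewrite ik.
have [P [P0 P1 PS]] := locus_path ik' SM dot_in_locus.
pose A := P *m map_mx (@polyC C) (perm_dot C W)^T.
have At t : map_mx (horner_eval t) A = curve_at P t *m (perm_dot C W)^T.
  rewrite map_mxM; congr (_ *m _); apply/matrixP => x y; first by rewrite !mxE.
  by rewrite [LHS]mxE [map_mx (@polyC C) _ _ _]mxE /= /horner_eval hornerC.
have [|q q1 qP] := ul_specialization (A := A); first by rewrite At P1 dot_trK.
have detA t : (\det A).[t] = \det (map_mx (horner_eval t) A).
  by rewrite det_map_mx.
have qA0 : (q * \det A).[1] != 0.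
  by rewrite hornerM detA At P1 dot_trK det1 mulr1.
rewrite -P0; apply: (@curve_vanish _ _ _ _ (q * \det A)).
  by apply: contraNneq qA0 => ->; rewrite horner0.
move=> t; rewrite hornerM mulf_eq0 negb_or => /andP[/qP[U [V [UV Ut Vt Lt]]] dA].
apply: f0; apply: (generic_in_cell (PS t) _ UV Ut Vt); last by rewrite -At.
move: dA; rewrite detA At det_mulmx mulf_eq0 negb_or => /andP[dP _].
by rewrite unitmxE unitfE.
Qed.

Lemma matrix_schubert_JK : matrix_schubert W = zero_locus (@JK_ideal C n i k).
Proof. by rewrite /matrix_schubert /zariski_closure -cell_vanishing. Qed.

Lemma matrix_schubert_ideal_JK : @matrix_schubert_ideal C n.+1 W = JK_ideal i k.
Proof.
rewrite -cell_vanishing; apply/seteqP; split=> f f0 M.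
  by move=> cM; apply: f0 => g; apply.
by apply.
Qed.

End BruhatCell.

(** * Intersections of incomparable primes *)

Section PrimeIntersections.
Variable A : comNzRingType.
Implicit Types (I P : set A) (x y f g : A).

Lemma prime_ideal_mul P x y : prime_ideal P -> P (x * y) -> P x \/ P y.
Proof.
by move=> [_ PP] /mem_set /PP /orP[] /set_mem; [left | right].
Qed.

Lemma prime_ideal_neq1 P : prime_ideal P -> ~ P 1.
Proof. by move=> [[_ P1 _] _] /mem_set; apply/negP. Qed.

Lemma prime_ideal_prod P (T : finType) (D : pred T) (F : T -> A) : prime_ideal P ->
  P (\prod_(i | D i) F i) -> exists2 i, D i & P (F i).
Proof.
move=> PP; elim/big_ind: _ => [/(prime_ideal_neq1 PP)//|x y IHx IHy|i Di]; last by exists i.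
by move=> /(prime_ideal_mul PP)[].
Qed.

Lemma prime_ideal_exp P f m : prime_ideal P -> P (f ^+ m) -> P f.
Proof.
move=> PP; elim: m => [/(prime_ideal_neq1 PP)//|m IH].
by rewrite exprS => /(prime_ideal_mul PP)[].
Qed.

Lemma is_ideal_prod P (T : finType) (D : pred T) (F : T -> A) i : is_ideal P ->
  D i -> P (F i) -> P (\prod_(j | D j) F j).
Proof.
by move=> [_ _ PM] Di PF; rewrite (bigD1 i) //= mulrC; apply: PM.
Qed.

Variables (T : finType) (D : set T) (Q : T -> set A).
Hypotheses (Qlike : forall i, D i -> is_ideal (Q i))
  (Qprime : forall i, D i -> prime_ideal (Q i))
  (Qsep : forall i j, D i -> D j -> i != j -> exists2 x, Q i x & ~ Q j x).
Let I := \bigcap_(i in D) Q i.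

(** A product of elements separating the [i]-th prime from each of the others. *)
Lemma prime_separator i : D i ->
  exists2 f, (forall j, D j -> j != i -> Q j f) & ~ Q i f.
Proof.
move=> Di.
have /choice[x xP] : forall j, exists x, D j -> j != i -> Q j x /\ ~ Q i x.
  move=> j; have [[Dj ji]|no] := pselect (D j /\ j != i).
    by have [x Qx Qix] := Qsep Dj Di ji; exists x.
  by exists 0 => Dj ji; case: no.
exists (\prod_(j | `[< D j >] && (j != i)) x j).
  move=> j Dj ji; apply: (@is_ideal_prod _ _ _ _ j (Qlike Dj)).
    by rewrite ji andbT; apply/asboolP.
  by case: (xP j Dj ji).
move=> /(prime_ideal_prod (Qprime Di))[j /andP[/asboolP Dj ji]].
by case: (xP j Dj ji).
Qed.

(** The annihilator of the class of [f] is the intersection of the [Q i] that do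
    not contain [f]; a prime that is a finite intersection is one of its terms. *)
Lemma associated_primes_cap : associated_primes I = [set Q i | i in D].
Proof.
apply/seteqP; split=> [P [PP [f PE]]|_ [i Di <-]].
  have Pg g : P g <-> forall i, D i -> Q i (g * f) by rewrite PE.
  have [[i [Di Qif QP]]|no] :=
    pselect (exists i, [/\ D i, ~ Q i f & Q i `<=` P]).
    exists i => //; apply/seteqP; split=> // g /Pg /(_ i Di).
    by move=> /(prime_ideal_mul (Qprime Di))[].
  have /choice[x xP] : forall i, exists x, D i -> ~ Q i f -> Q i x /\ ~ P x.
    move=> i; have [[Di Qif]|no'] := pselect (D i /\ ~ Q i f); last first.
      by exists 0 => Di Qif; case: no'.
    apply: contrapT => nx; apply: no; exists i; split=> // x Qx.
    by apply: contrapT => nPx; apply: nx; exists x.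
  have : P (\prod_(i | `[< D i /\ ~ Q i f >]) x i).
    apply/Pg => i Di; have [Qif|Qif] := pselect (Q i f).
      by case: (Qlike Di) => _ _; apply.
    rewrite mulrC; case: (Qlike Di) => _ _; apply.
    apply: (@is_ideal_prod _ _ _ _ i (Qlike Di)); first exact/asboolP.
    by case: (xP i Di Qif).
  by move=> /(prime_ideal_prod PP)[i /asboolP[Di Qif]]; case: (xP i Di Qif).
split; first exact: Qprime.
have [f fQ Qif] := prime_separator Di; exists f; apply/seteqP; split=> g.
  move=> Qg j Dj; have [->|ji] := eqVneq j i.
    by rewrite mulrC; case: (Qlike Di) => _ _; apply.
  by case: (Qlike Dj) => _ _; apply; apply: fQ.
by move=> /(_ i Di) /(prime_ideal_mul (Qprime Di))[].
Qed.

Lemma saturation_cap d : (forall i, D i -> ~ Q i d) -> saturation d I = I.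
Proof.
move=> Qd; apply/seteqP; split=> [f [m If] i Di|f If].
  by have /(prime_ideal_mul (Qprime Di))[/(prime_ideal_exp (Qprime Di))/(Qd i Di)|] :=
    If i Di.
by exists 0%N; rewrite mul1r.
Qed.

Lemma reduced_cap : reduced_quotient I.
Proof. by move=> f m If i Di; apply: (prime_ideal_exp (Qprime Di) (If i Di)). Qed.

End PrimeIntersections.

Lemma zero_locus_cap (C : fieldType) (n : nat) (T : finType) (D : set T)
    (Q : T -> set (coord_ring C n)) : (forall i, D i -> is_ideal (Q i)) ->
  zero_locus (\bigcap_(i in D) Q i) = \bigcup_(i in D) zero_locus (Q i).
Proof.
move=> Qlike; apply/seteqP; split=> M; last first.
  by move=> [i Di Mi] f fQ; apply: Mi; apply: fQ.
move=> MI; apply: contrapT => no.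
have /choice[x xP] : forall i, exists x, D i -> Q i x /\ eval_mx M x != 0.
  move=> i; have [Di|nD] := pselect (D i); last by exists 0 => Di.
  apply: contrapT => nx; apply: no; exists i => // f Qf.
  by apply/eqP/negPn/negP => Mf; apply: nx; exists f.
have := MI (\prod_(i | `[< D i >]) x i).
have -> : eval_mx M (\prod_(i | `[< D i >]) x i) =
    \prod_(i | `[< D i >]) eval_mx M (x i).
  by rewrite /eval_mx rmorph_prod.
move=> E; have /eqP : \prod_(i | `[< D i >]) eval_mx M (x i) = 0.
  apply: E => i Di; apply: (@is_ideal_prod _ _ _ _ _ i (Qlike i Di)); first exact/asboolP.
  by case: (xP i Di).
apply/negP; apply/prodf_neq0 => i /asboolP Di.
by case: (xP i Di).
Qed.

(** * Separating the components *)

Section Corners.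
Variables (C : numFieldType) (n : nat) (h : 'I_n.+1 -> 'I_n.+1).
Hypotheses (n_gt0 : (0 < n)%N) (h_hess : hessenberg h) (h_indec : indecomposable h).
Let Q (i : 'I_n.+1) : set (coord_ring C n.+1) := JK_ideal i (h i).

(** A point of the locus with entries 1 right below the diagonal in the columns
    before [h j], and 0 elsewhere: the submatrix cut out by [B] is the identity. *)
Lemma minor_notin_JK (i j : 'I_n.+1) (B : 'I_(h i).+1 -> 'I_n.+1) :
  (j < h j)%N -> (h i < h j)%N -> (forall c, B c = c.+1 :> nat) ->
  ~ Q j (minor_poly C B).
Proof.
move=> jh ij BE /JK_sub_vanishing.
pose M : 'M[C]_n.+1 := \matrix_(r, c) ((r == c.+1 :> nat) && (c < h j)%N)%:R.
move=> /(_ M) E; suff : degeneracy_locus j n (h j) M.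
  move=> /E; rewrite eval_minor (_ : mxsub _ _ _ = 1%:M).
    by rewrite det1 => /eqP; rewrite oner_eq0.
  apply/matrixP => c d; rewrite !mxE BE eqSS /=.
  by rewrite (leq_trans (ltn_ord d) ij) andbT.
split=> [c cj|].
  rewrite mxE inordK // [n == _]gtn_eqF //=.
  by rewrite -ltnS; apply: leq_trans (ltn_ord (h j)); rewrite ltnS (leq_ltn_trans cj).
exists (fun=> 0) => r _; rewrite inord_val mxE ltnn andbF big1 // => c _.
by rewrite mul0r.
Qed.

(** For corners [i < j], a minor of size [h i + 1] (0-based) separates one way,
    and the entry of the last row in column [i] the other way. *)
Lemma corner_JK_sep (i j : 'I_n.+1) : corners h i -> corners h j -> i != j ->
  exists2 x, Q i x & ~ Q j x.
Proof.
move=> ci cj; rewrite -val_eqE /= neq_ltn => /orP[ij|ji].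
  have hij := corner_hess_lt h_hess cj ij.
  have hi_lt (c : 'I_(h i).+1) : (c.+1 < n.+1)%N.
    exact: leq_ltn_trans (leq_trans (ltn_ord c) hij) (ltn_ord (h j)).
  exists (minor_poly C (fun c => Ordinal (hi_lt c))).
    by apply: ideal_add_subr; [exact: J0_is_ideal | apply: K_minor].
  by apply: minor_notin_JK => //; apply: corner_lt.
exists (generic_mx C n.+1 ord_max j).
  by apply: ideal_add_subl; [exact: K_is_ideal | exact: J0_var].
by apply: var_notin_JK; apply: corner_lt.
Qed.

Lemma det_notin_JK (i k : 'I_n.+1) : (i < k)%N ->
  ~ JK_ideal i k (\det (generic_mx C n.+1)).
Proof.
move=> ik /JK_sub_vanishing /(_ _ (dot_in_locus C ik)) E.
have [+ _] := mulmx1_unit (dot_trK C i k).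
rewrite unitmxE unitfE => /eqP; apply.
rewrite -E /eval_mx -det_map_mx; congr (\det _).
by apply/matrixP => x y; rewrite -eval_generic /eval_mx [RHS]mxE.
Qed.

End Corners.

(** * The theorem *)

Unset Implicit Arguments.

(* The complex numbers are R[i] for R : realType.  Closed subschemes of M_n are
   given by their ideals, so that the ideal of a union is the intersection of
   the ideals; the equality Y = \bigcup X_w is stated both for the schemes and
   for the underlying sets of closed points. *)
Theorem proposition7p2 (R : realType) (n : nat) (h : 'I_n -> 'I_n)
    (n_ge2 : (2 <= n)%N) (h_hess : hessenberg h)
    (h_indec : indecomposable h) :
  let N : 'M[R[i]]_n := nilp_mx R[i] n in
  let Q (i : 'I_n) : set (coord_ring R[i] n) :=
    ideal_add (ideal_J0 i) (ideal_K (h i)) in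
  let w (i : 'I_n) := perm_w i (h i) in
  [/\ hess_ideal N h = \bigcap_(i in corners h) Q i,
      associated_primes (hess_ideal N h) = [set Q i | i in corners h],
      reduced_quotient (hess_scheme_ideal N h),
      hess_scheme_ideal N h =
        \bigcap_(i in corners h)
          matrix_schubert_ideal (perm_comp (perm_w0 n) (w i)) /\
      zero_locus (hess_scheme_ideal N h) =
        \bigcup_(i in corners h)
          matrix_schubert (perm_comp (perm_w0 n) (w i))
    & forall i, corners h i ->
        is_shortest
          (fun s : 'S_n => (s i == 0%N :> nat) && ((s (h i)).+1 == n)) (w i)].
Proof.
case: n => // n' in h n_ge2 h_hess h_indec *.
have n_gt0 : (0 < n')%N by [].
move=> N Q w.
have Qlike i : corners h i -> is_ideal (Q i) by move=> _; apply: JK_is_ideal.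
have ci_lt i : corners h i -> (i < h i)%N by apply: corner_lt.
have Qprime i : corners h i -> prime_ideal (Q i).
  by move=> /ci_lt ih; apply: JK_prime; rewrite ih.
have Qsep := corner_JK_sep R[i] n_gt0 h_hess h_indec.
have IE : hess_ideal N h = \bigcap_(i in corners h) Q i.
  exact: hess_ideal_cap.
have SE : hess_scheme_ideal N h = \bigcap_(i in corners h) Q i.
  rewrite /hess_scheme_ideal IE; apply: saturation_cap => // i /ci_lt.
  exact: det_notin_JK.
have XQ i : corners h i ->
    @matrix_schubert_ideal R[i] _ (perm_comp (perm_w0 n'.+1) (w i)) = Q i.
  by move=> /ci_lt; apply: matrix_schubert_ideal_JK.
split.
- by [].
- by rewrite IE; apply: associated_primes_cap.
- by rewrite SE; apply: reduced_cap.
- rewrite SE; split; first by apply: eq_bigcapr => i /XQ.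
  rewrite zero_locus_cap //; apply: eq_bigcupr => i /ci_lt ih.
  by rewrite matrix_schubert_JK.
- by move=> i /ci_lt; apply: perm_w_shortest.
Qed.
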